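(* Assume that there exist a strictly increasing sequence of real numbers $\{\alpha_j\}_{j=0}^n$ and real constants $\gamma_j$ ($j=0,\dots,n$) such that, for every $j\in\{0,\dots,n\}$, $$a\,|h(x)-\gamma_j|<(-1)^jg(x)\qquad\text{for all } x\in\left(\alpha_j-\tfrac{aT}{2},\alpha_j+\tfrac{aT}{2}\right).$$ Then, for any continuous $T$-periodic function $p:\mathbb{T}\to\mathbb{R}$ with mean value zero, i.e. $\frac1T\int_0^T p(t)\,\Delta t=0$, the equation $$(\varphi(x^{\Delta}(t)))^{\Delta}+h(x(t))x^{\Delta}(t)+g(x(t-r))=p(t),\qquad t\in\mathbb{T},$$ has at least $n$ different $T$-periodic solutions.
   Context: Setting: $T>0$ and $r\ge 0$ are real numbers. $\mathbb{T}\subset\mathbb{R}$ is a time scale (a nonempty closed subset of $\mathbb{R}$) that is $T$-periodic, i.e. $\mathbb{T}+T=\mathbb{T}$, with $\mathbb{T}-r\subset\mathbb{T}$ and $0\in\mathbb{T}$. $x^\Delta$ denotes the usual (Hilger) delta derivative on $\mathbb{T}$ and $\int\cdot\,\Delta t$ the usual delta integral on $\mathbb{T}$. $\varphi:(-a,a)\to\mathbb{R}$ is an increasing homeomorphism with $0<a<+\infty$ and $\varphi(0)=0$; $h,g:\mathbb{R}\to\mathbb{R}$ are continuous functions. $C^1_T$ is the Banach space of all continuous $T$-periodic functions $x:\mathbb{T}\to\mathbb{R}$ that are $\Delta$-differentiable with continuous $\Delta$-derivative. A $T$-periodic solution of the equation is a function $x\in C^1_T$ with $|x^\Delta(t)|<a$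 for all $t\in\mathbb{T}$ (so that $\varphi(x^\Delta)$ is defined), such that $\varphi(x^\Delta)$ is of class $C^1$ (i.e. $\Delta$-differentiable with continuous $\Delta$-derivative), and satisfying the equation for all $t\in\mathbb{T}$. Solutions are different if they are different as functions on $\mathbb{T}$. *)

(* Defs.v *)
From HB Require Import structures.
From mathcomp Require Import all_boot all_order all_algebra.
From mathcomp Require Import all_classical all_reals all_analysis.

Set Implicit Arguments.
Unset Strict Implicit.
Unset Printing Implicit Defensive.

Import Order.TTheory GRing.Theory Num.Theory.
Import numFieldNormedType.Exports.

Local Open Scope classical_set_scope.
Local Open Scope ring_scope.

(* A function on a time scale TS is represented by a total function R -> R of
   which only the values on TS are ever used. *)

Definition time_scale (R : realType) (TS : set R) : Prop :=
  TS !=set0 /\ closed TS.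

(* For a time scale that is unbounded above, which every periodic one is, this
   is an infimum of a nonempty set. *)
Definition forward_jump (R : realType) (TS : set R) (t : R) : R :=
  inf [set s | TS s /\ t < s].

Definition is_delta_derive (R : realType) (TS : set R) (x : R -> R) (t l : R)
    : Prop :=
  forall e : R, 0 < e ->
    \forall s \near t, TS s ->
      `| x (forward_jump TS t) - x s - l * (forward_jump TS t - s) |
        <= e * `| forward_jump TS t - s |.

Definition delta_derivable (R : realType) (TS : set R) (x : R -> R) (t : R)
    : Prop :=
  exists l : R, is_delta_derive TS x t l.

(* Equal to 0 where x is not delta-differentiable. *)
Definition delta_derive (R : realType) (TS : set R) (x : R -> R) (t : R) : R :=
  xget 0 [set l | is_delta_derive TS x t l].

Definition delta_C1 (R : realType) (TS : set R) (x : R -> R) : Prop :=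
  (forall t, TS t -> delta_derivable TS x t) /\
  {within TS, continuous (delta_derive TS x)}.

(* The Cauchy delta integral: the increment F b - F a of an antiderivative F. *)
Definition is_delta_integral (R : realType) (TS : set R) (f : R -> R)
    (a b I : R) : Prop :=
  exists F : R -> R,
    (forall t, TS t -> is_delta_derive TS F t (f t)) /\ I = F b - F a.

(* Every continuous f has an antiderivative on TS, unique up to a constant, so
   for such f and a, b in TS the default value 0 is not used. *)
Definition delta_integral (R : realType) (TS : set R) (f : R -> R) (a b : R)
    : R :=
  xget 0 [set I | is_delta_integral TS f a b I].

Definition periodic_on (R : realType) (TS : set R) (T : R) (x : R -> R)
    : Prop :=
  forall t, TS t -> x (t + T) = x t.

Definition C1_periodic (R : realType) (TS : set R) (T : R) (x : R -> R)
    : Prop :=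
  [/\ {within TS, continuous x}, periodic_on TS T x & delta_C1 TS x].

(* phi restricts to an increasing homeomorphism from (-a, a) onto R; psi is the
   inverse. *)
Definition increasing_homeo (R : realType) (a : R) (phi : R -> R) : Prop :=
  [/\ {in `]- a, a[ &, {homo phi : u v / u < v}},
      {within [set` `]- a, a[], continuous phi} &
      exists psi : R -> R,
        [/\ continuous psi,
            forall y, psi y \in `]- a, a[,
            forall y, phi (psi y) = y &
            {in `]- a, a[, forall u, psi (phi u) = u}]].

Definition periodic_solution (R : realType) (TS : set R) (T r a : R)
    (phi h g p x : R -> R) : Prop :=
  [/\ C1_periodic TS T x,
      forall t, TS t -> `| delta_derive TS x t | < a,
      delta_C1 TS (phi \o delta_derive TS x) &
      forall t, TS t ->
        delta_derive TS (phi \o delta_derive TS x) t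
          + h (x t) * delta_derive TS x t + g (x (t - r)) = p t].

(* Main.v *)
Require Import Defs.
From HB Require Import structures.
From mathcomp Require Import all_boot all_order all_algebra.
From mathcomp Require Import all_classical all_reals all_analysis.
From mathcomp Require Import ring lra measurable_realfun finmap.

Set Implicit Arguments.
Unset Strict Implicit.
Unset Printing Implicit Defensive.

Import Order.TTheory GRing.Theory Num.Theory.
Import numFieldNormedType.Exports.

(** Two remarks give the sign of a mean value.  A T-periodic x whose delta
derivative has absolute value less than a oscillates by less than a T / 2, since
within one period it has to come back to its starting value
([periodic_oscillation]); so a solution with x(0) = alpha_j stays in the j-th
interval of the hypothesis.  Moreover the delta derivative of x has mean zero,
and the period mean is invariant under the delay because TS - r is all of TS
([TS_delay_shift], [mean_shift]); so the mean of h(x) x^Delta + g(x(t - r)) is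
the mean of (h(x) - gamma_j) x^Delta + g(x), in which g wins and the sign is
that of (-1)^j ([mean_force_gt0]).

As p has mean zero, integrating the equation over a period shows that this mean
must vanish, and between alpha_j and alpha_{j+1} it changes sign.  The rest of
the equation need not determine x from x(0), because h and g are only
continuous; the change of sign is therefore exploited inside one fixed point
problem for pairs (c, u), where c stands for x(0) and u for phi(x^Delta).  With
psi the inverse of phi, such a pair gives the T-periodic function x equal to c
plus the primitive of psi(u) minus its mean.  The map [next_state] sends u to a
primitive of p minus the force, mean removed, started at u(0) minus the mean of
psi(u) clipped to [-D, D], and c to c + (-1)^j times the mean of the force,
clipped to [alpha_j, alpha_{j+1}].  At a fixed point neither clipping can be
active: u(0) = D would force u, hence psi(u), to be positive everywhere, and at
the two ends of [alpha_j, alpha_{j+1}] the mean of the force pushes inwards.  So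
both means vanish ([fixed_mean_vel], [fixed_mean_force]), which says exactly that
x is a T-periodic solution, with alpha_j < x(0) < alpha_{j+1}.  The n gaps
between consecutive alpha_j give n solutions with different values at 0.

The functions u produced by the map are uniformly bounded and uniformly
Lipschitz on TS.  The pairs with such u form a convex set that is compact for
pointwise convergence, and for Lipschitz periodic functions pointwise convergence is
uniform on TS, which makes the map continuous.  The fixed point then comes from
the Schauder-Tychonoff theorem ([schauder_tychonoff]).  That theorem is reduced to
Brouwer's by a partition of unity, and Brouwer's theorem is the limit, as the
mesh tends to 0, of a discrete statement on a grid
([discrete_poincare_miranda]), proved by a Stokes formula modulo 2.

On a time scale two facts replace ordinary calculus: a mean value inequality
([delta_mean_value]), from which primitives are unique, and the existence of
primitives of continuous functions ([ex_delta_antiderivative]), by Lebesgue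
integration of the function that is constant on the gaps of TS. *)

Local Open Scope ring_scope.

(** * A discrete Poincare-Miranda theorem *)

Section DiscretePoincareMiranda.
Variable n : nat.
Implicit Types (b : 'I_n -> nat) (i j : 'I_n) (js : seq 'I_n) (D : {set 'I_n}).

Definition set_coord b j v : 'I_n -> nat := fun i => if i == j then v else b i.
Definition step b j : 'I_n -> nat := set_coord b j (b j).+1.

Variable s : 'I_n -> ('I_n -> nat) -> bool.

Definition bit j b : 'F_2 := (s j b)%:R.

(** The cup product modulo 2 of the coboundaries of the sign functions [s j], for j
    in [js], evaluated on the cube with lowest vertex [b] and edge directions
    [D]: the sum over the monotone paths from [b] that use each direction at
    most once, of the products of the successive jumps of the [s j].  The
    recursion peels off the first edge of the path. *)
Fixpoint cup js b D : 'F_2 :=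
  if js is j :: js' then
    \sum_(i in D) (bit j (step b i) + bit j b) * cup js' (step b i) (D :\ i)
  else 1.

Lemma addF2 (x : 'F_2) : x + x = 0.
Proof. by rewrite -mulr2n -mulr_natr pchar_Zp ?mulr0. Qed.

Lemma addF2_eq (x y : 'F_2) : x + y = 0 -> x = y.
Proof. by move/(congr1 (+%R^~ y)); rewrite -addrA addF2 addr0 add0r. Qed.

Lemma stepC b i j : step (step b i) j = step (step b j) i.
Proof.
have [->//|ij] := eqVneq i j; apply: funext => k; rewrite /step /set_coord.
rewrite (negbTE ij) [j == i]eq_sym (negbTE ij).
by have [->|//] := eqVneq k j; rewrite eq_sym (negbTE ij).
Qed.

(** Modulo 2 the contributions of (i, j) and (j, i) cancel. *)
Lemma sum_sym D (F : 'I_n -> 'I_n -> 'F_2) : (forall i j, F i j = F j i) ->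
  \sum_(i in D) \sum_(j in D :\ i) F i j = 0.
Proof.
move=> FC; pose G i j := (i < j)%N.
have -> : \sum_(i in D) \sum_(j in D :\ i) F i j =
    \sum_(i in D) (\sum_(j in D | G i j) F i j + \sum_(j in D | G j i) F i j).
  apply: eq_bigr => i _; rewrite (bigID (G i)) /=; congr (_ + _);
    apply: eq_bigl => j; rewrite !inE /G; case: (j \in D); rewrite ?andbF ?andbT //=;
    by rewrite -val_eqE /=; case: ltngtP.
rewrite big_split /= [X in _ + X](exchange_big_dep (mem D)) /=;
  last by move=> i j _ /andP[].
rewrite -[RHS](addF2 (\sum_(i in D) \sum_(j in D | G i j) F i j)); congr (_ + _).
apply: eq_bigr => i iD; apply: eq_big => [j|j _]; last exact: FC.
by rewrite iD /=.
Qed.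

(** A cup product of coboundaries is a cocycle: its values on the opposite
    faces of a cube add up to 0.  Expanding the first edge of every path, the
    terms that depend symmetrically on the first two directions cancel by
    [sum_sym], and the others are instances of the same identity for one sign
    function less. *)
Lemma cup_closed js b D :
  \sum_(j in D) (cup js (step b j) (D :\ j) + cup js b (D :\ j)) = 0.
Proof.
elim: js b D => [|k js IH] b D /=.
  by apply: big1 => j _; exact: addF2.
pose t := bit k.
have DD i j : D :\ i :\ j = D :\ j :\ i by rewrite !finset.setDDl finset.setUC.
pose A i j := t (step (step b i) j) * cup js (step (step b i) j) (D :\ i :\ j).
pose B i j := t (step b j) * cup js (step (step b i) j) (D :\ i :\ j).
pose E i j := t (step b j) * cup js (step b j) (D :\ i :\ j).
pose H i j := t b * cup js (step b j) (D :\ i :\ j).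
have -> : \sum_(j in D) (\sum_(i in D :\ j)
   (t (step (step b j) i) + t (step b j)) * cup js (step (step b j) i) (D :\ j :\ i) +
   \sum_(i in D :\ j) (t (step b i) + t b) * cup js (step b i) (D :\ j :\ i)) =
  \sum_(j in D) \sum_(i in D :\ j) A j i +
  \sum_(j in D) \sum_(i in D :\ j) (B i j + E i j) +
  \sum_(j in D) \sum_(i in D :\ j) H j i.
  (* B and E are the two halves of the induction hypothesis at the vertex
     step b j; renaming the summation indices in one of them aligns the bases. *)
  have -> : \sum_(j in D) \sum_(i in D :\ j) (B i j + E i j) =
            \sum_(j in D) \sum_(i in D :\ j) (B i j + E j i).
    under eq_bigr do rewrite big_split; under [RHS]eq_bigr do rewrite big_split.
    rewrite !big_split /=; congr (_ + _).
    rewrite (exchange_big_dep (mem D)) /=; last by move=> i j _ /finset.setD1P[].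
    apply: eq_bigr => i iD; apply: eq_bigl => j; rewrite !inE iD andbT eq_sym.
    by rewrite andbC.
  rewrite -!big_split; apply: eq_bigr => j _.
  rewrite -!big_split; apply: eq_bigr => i _; rewrite /A /B /E /H.
  rewrite [step (step b i) j]stepC (DD i j) /=; ring.
rewrite sum_sym ?add0r; last by move=> i j; rewrite /A stepC DD.
have -> : \sum_(j in D) \sum_(i in D :\ j) (B i j + E i j) = 0.
  apply: big1 => j jD;
    rewrite -[RHS](mulr0 (t (step b j))) -[in RHS](IH (step b j) (D :\ j)).
  rewrite mulr_sumr. apply: eq_bigr => i _.
  by rewrite /B /E [step (step b i) j]stepC DD mulrDr.
rewrite add0r -[RHS](sum_sym D (F := fun i j => t b * cup js b (D :\ i :\ j)));
  last first.
  by move=> i j; rewrite DD.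
apply: eq_bigr => j jD; rewrite /H -!mulr_sumr; congr (_ * _).
by apply: addF2_eq; rewrite -big_split; exact: IH.
Qed.

(** Being closed, the product of the remaining coboundaries can be transported
    along the first edge, so that the cup product becomes the coboundary of the
    cochain [bit j * cup js]: the Leibniz rule read backwards. *)
Lemma cup_stokes j js b D :
  cup (j :: js) b D =
  \sum_(i in D) (bit j (step b i) * cup js (step b i) (D :\ i) +
                 bit j b * cup js b (D :\ i)).
Proof.
have /(congr1 ( *%R (bit j b))) := cup_closed js b D.
rewrite mulr0 mulr_sumr /= => e.
rewrite -[RHS]addr0 -[X in _ = _ + X]e -big_split; apply: eq_bigr => i _ /=.
(* The two sides differ by twice this term, which is 0 modulo 2. *)
rewrite -[LHS]addr0 -(addF2 (bit j b * cup js b (D :\ i))); ring.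
Qed.

Variable k : nat.

Fixpoint box_sum js (G : ('I_n -> nat) -> 'F_2) b : 'F_2 :=
  if js is j :: js' then \sum_(v < k) box_sum js' G (set_coord b j v) else G b.

Lemma set_coordC b i j v w : i != j ->
  set_coord (set_coord b i v) j w = set_coord (set_coord b j w) i v.
Proof.
move=> ij; apply: funext => l; rewrite /set_coord.
by have [->|//] := eqVneq l j; rewrite eq_sym (negbTE ij).
Qed.

Lemma set_coord_id b i v w : set_coord (set_coord b i v) i w = set_coord b i w.
Proof. by apply: funext => l; rewrite /set_coord; case: eqVneq. Qed.

Lemma step_set_coord b i v : step (set_coord b i v) i = set_coord b i v.+1.
Proof. by rewrite /step set_coord_id /set_coord eqxx. Qed.

Lemma step_set_coordC b i j v : i != j -> step (set_coord b i v) j = set_coord (step b j) i v.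
Proof.
move=> ij; rewrite /step set_coordC //; congr (set_coord (set_coord b j _) i v).
by rewrite /set_coord eq_sym (negbTE ij).
Qed.

Lemma eq_box_sum js G1 G2 : G1 =1 G2 -> box_sum js G1 =1 box_sum js G2.
Proof.
by move=> e; elim: js => //= j js IH b; apply: eq_bigr => v _; exact: IH.
Qed.

Lemma box_sumD js G1 G2 b :
  box_sum js (fun b => G1 b + G2 b) b = box_sum js G1 b + box_sum js G2 b.
Proof.
elim: js b => //= j js IH b; rewrite -big_split; apply: eq_bigr => v _.
exact: IH.
Qed.

Lemma box_sum_sum js (P : pred 'I_n) (G : 'I_n -> ('I_n -> nat) -> 'F_2) b :
  box_sum js (fun b => \sum_(i | P i) G i b) b = \sum_(i | P i) box_sum js (G i) b.
Proof.
elim: js b => //= j js IH b; rewrite exchange_big; apply: eq_bigr => v _.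
exact: IH.
Qed.

Lemma box_sum_face0 js (G : ('I_n -> nat) -> 'F_2) j v b : j \notin js ->
  (forall b, b j = v -> G b = 0) -> b j = v -> box_sum js G b = 0.
Proof.
move=> + G0; elim: js b => [b _|i js IH b] /=; first exact: G0.
rewrite inE negb_or => /andP[ji jjs] bj; apply: big1 => w _.
by apply: IH => //; rewrite /set_coord (negbTE ji).
Qed.

Lemma box_sum_step js G j b : j \notin js ->
  box_sum js (G \o step^~ j) b = box_sum js G (step b j).
Proof.
elim: js b => [//|i js IH b]; rewrite inE negb_or => /andP[ji jjs] /=.
by apply: eq_bigr => v _; rewrite IH // step_set_coordC // eq_sym.
Qed.

Lemma sum_telescope (f : nat -> 'F_2) m :
  \sum_(v < m) (f v.+1 + f v) = f m + f 0%N.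
Proof.
elim: m => [|m IH]; first by rewrite big_ord0 addF2.
by rewrite big_ord_recr /= IH addrC addrA -[f m.+1 + _ + _]addrA addF2 addr0.
Qed.

Lemma box_sum_telescope j js G b : j \notin js ->
  box_sum (j :: js) (fun b => G (step b j) + G b) b =
  box_sum js G (set_coord b j k) + box_sum js G (set_coord b j 0%N).
Proof.
move=> jjs /=; rewrite -(sum_telescope (fun v => box_sum js G (set_coord b j v))).
apply: eq_bigr => v _; rewrite box_sumD; congr (_ + _).
by rewrite -step_set_coord -box_sum_step.
Qed.

Lemma box_sum_telescope0 j js G b : uniq js -> j \in js ->
  (forall b, b j = 0%N \/ b j = k -> G b = 0) ->
  box_sum js (fun b => G (step b j) + G b) b = 0.
Proof.
move=> + + G0; elim: js b => [//|i js IH] b /= /andP[ijs ujs].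
rewrite inE; have [ij|ji] /= := eqVneq j i.
  move=> _; subst j; have := box_sum_telescope G b ijs => /= ->.
  have G00 v : v = 0%N \/ v = k -> box_sum js G (set_coord b i v) = 0.
    move=> v0k; apply: (@box_sum_face0 _ _ i v) => // [c ci|];
      last by rewrite /set_coord eqxx.
    by apply: G0; rewrite ci.
  by rewrite !G00 ?addr0; auto.
by move=> jjs; apply: big1 => v _; exact: IH.
Qed.

Hypothesis s_lo : forall j b, b j = 0%N -> s j b.
Hypothesis s_hi : forall j b, b j = k -> ~~ s j b.

(** On a face on which coordinate j is 0 or k, the sign [s j] is constant, so
    its coboundary contributes a factor 0 to every path. *)
Lemma cup_face0 j js b D : j \in js -> j \notin D -> b j = 0%N \/ b j = k ->
  cup js b D = 0.
Proof.
elim: js b D => [//|i js IH] b D; rewrite inE => jjs jD bj /=.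
apply: big1 => l lD; have lj : j != l by apply: contraNneq jD => ->.
have bj' : step b l j = b j by rewrite /step /set_coord (negbTE lj).
have /orP[/eqP <-|{}jjs] := jjs.
  suff -> : bit j (step b l) = bit j b by rewrite addF2 mul0r.
  rewrite /bit; case: bj => bj; first by rewrite !s_lo ?bj'.
  by rewrite !(negbTE (s_hi _)) ?bj'.
by rewrite IH ?mulr0 ?bj'// !inE negb_and jD orbT.
Qed.

(** Stokes on the whole box.  By [cup_stokes] the sum telescopes to faces of the
    box; by [cup_face0] only the two faces in the first direction j can
    contribute, where [s j] is 1 on the lower one and 0 on the upper one.  What
    is left is the same sum in one dimension less. *)
Lemma box_sum_cup js b D : uniq js -> D =i js -> box_sum js (fun b => cup js b D) b = 1.
Proof.
elim: js b D => [//|j js IH] b D ujjs Djs.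
have /andP[jjs ujs] : (j \notin js) && uniq js := ujjs.
rewrite (@eq_box_sum (j :: js) (fun c => cup (j :: js) c D) _
  (fun c => cup_stokes j js c D)).
rewrite box_sum_sum (bigD1 j) ?Djs ?mem_head//=.
rewrite [X in _ + X]big1 ?addr0 => [|i /andP[iD ij]]; last first.
  have ijs : i \in j :: js by rewrite -Djs.
  have /= := @box_sum_telescope0 i (j :: js) (fun b => bit j b * cup js b (D :\ i)) b ujjs ijs.
  apply=> c ci; rewrite (@cup_face0 i) ?mulr0 ?finset.setD11//.
  by move: ijs; rewrite inE (negbTE ij).
have /= -> := box_sum_telescope (fun b => bit j b * cup js b (D :\ j)) b jjs.
rewrite (@box_sum_face0 _ _ j k) // ?add0r; last 2 first.
- by move=> {}b bj; rewrite /bit (negbTE (s_hi bj)) mul0r.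
- by rewrite /set_coord eqxx.
rewrite -[RHS](IH (set_coord b j 0%N) (D :\ j)) //; last first.
  move=> i; rewrite !inE Djs inE; have [->|//] := eqVneq i j.
  by rewrite (negbTE jjs).
apply: addF2_eq; rewrite -box_sumD.
apply: (@box_sum_face0 _ _ j 0%N); rewrite ?/set_coord ?eqxx // => {}b bj.
by rewrite /bit (s_lo bj) mul1r addF2.
Qed.

Lemma box_sum_neq0 js G b : box_sum js G b != 0 ->
  exists c, [/\ G c != 0, forall j, j \in js -> (c j < k)%N &
                forall j, j \notin js -> c j = b j].
Proof.
elim: js b => [|i js IH] b /=; first by move=> Gb; exists b.
have [/existsP[v /IH[c [Gc clt cb]]] _|/existsPn ex] :=
  boolP [exists v : 'I_k, box_sum js G (set_coord b i v) != 0]; last first.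
  by rewrite big1 ?eqxx// => v _; apply/eqP; move: (ex v); rewrite negbK.
exists c; split=> // j; rewrite inE; last first.
  by rewrite negb_or => /andP[ji /cb ->]; rewrite /set_coord (negbTE ji).
have [jjs _|jjs] := boolP (j \in js); first exact: clt.
by rewrite orbF => /eqP ji; rewrite cb // /set_coord ji eqxx.
Qed.

(** A path with nonzero product crosses a jump of every sign function, and all
    its vertices lie in the same unit cube. *)
Lemma cup_neq0 js b D : cup js b D != 0 -> forall j, j \in js ->
  exists p q, [/\ s j p, ~~ s j q, forall i, (b i <= p i <= b i + (i \in D))%N &
     forall i, (b i <= q i <= b i + (i \in D))%N].
Proof.
elim: js b D => [//|i js IH] b D /= ne0 j.
have [/existsP[l /andP[lD]]|/existsPn ex] :=
  boolP [exists l, (l \in D) &&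
    ((bit i (step b l) + bit i b) * cup js (step b l) (D :\ l) != 0)]; last first.
  move: ne0; rewrite big1 ?eqxx // => l lD; move: (ex l); rewrite lD /= negbK.
  by move=> /eqP.
rewrite mulf_eq0 negb_or => /andP[sne /IH{}IH].
have bstep (c : 'I_n -> nat) (ce : forall m, (step b l m <= c m <= step b l m + (m \in D :\ l))%N)
  m : (b m <= c m <= b m + (m \in D))%N.
  have := ce m; rewrite /step /set_coord !inE; have [->|ml] //= := eqVneq m l.
  by rewrite lD addn0 addn1 => /andP[/ltnW -> ->].
rewrite inE => /orP[/eqP ->|/IH[p [q [sp sq pb qb]]]]; last first.
  by exists p, q; split=> // m; exact: bstep.
have b0 m : (b m <= b m <= b m + (m \in D))%N by rewrite leqnn leq_addr.
have b1 m : (b m <= step b l m <= b m + (m \in D))%N.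
  by apply: bstep => {}m; rewrite leqnn leq_addr.
move: sne; rewrite /bit; have [sl|sl] := boolP (s i (step b l));
  have [sb|sb] := boolP (s i b); rewrite ?addF2 ?addr0 ?eqxx // => _.
- by exists (step b l), b.
- by exists b, (step b l).
Qed.

(** The cup products over all cells add up to 1, so one of them is nonzero. *)
Theorem discrete_poincare_miranda : exists b : 'I_n -> nat,
  (forall j, b j < k)%N /\
  forall j, exists p q, [/\ s j p, ~~ s j q, forall i, (b i <= p i <= (b i).+1)%N &
     forall i, (b i <= q i <= (b i).+1)%N].
Proof.
have := @box_sum_cup (enum 'I_n) (fun=> 0%N) [set: 'I_n] (enum_uniq _).
have eT : [set: 'I_n] =i enum 'I_n by move=> i; rewrite mem_enum !inE.
move=> /(_ eT) sum1.
have /box_sum_neq0[b [cb bk _]] :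
    box_sum (enum 'I_n) ((cup (enum 'I_n))^~ [set: 'I_n]) (fun=> 0%N) != 0.
  by rewrite sum1 oner_eq0.
exists b; split=> [j|j]; first by apply: bk; rewrite mem_enum.
have [|p [q [sp sq pb qb]]] := cup_neq0 cb (j := j); first by rewrite mem_enum.
by exists p, q; split=> // i; [move: (pb i)|move: (qb i)]; rewrite inE addn1.
Qed.

End DiscretePoincareMiranda.

Local Open Scope classical_set_scope.
Local Open Scope ring_scope.

(** * Brouwer's fixed point theorem on the cube *)

Definition unit_cube (R : realType) (n : nat) : set 'rV[R]_n :=
  [set v | forall i, 0 <= v 0 i <= 1].
Arguments unit_cube : clear implicits.

Lemma unit_cube_compact (R : realType) n : compact (unit_cube R n).
Proof.
have := @rV_compact R n (fun=> `[0, 1]%classic) (fun=> @segment_compact R 0 1).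
by congr compact; apply/seteqP; split=> v /= vc i; have := vc i; rewrite in_itv.
Qed.

(** Give a grid point the j-th sign true when [f] does not decrease its j-th
    coordinate.  Some small cell contains, for every j, a point moved weakly up
    and a point moved weakly down.  At an accumulation point of these cells, as
    the mesh tends to 0, every coordinate of [f] is both at least and at most
    that of the point. *)
Theorem brouwer_unit_cube (R : realType) n (f : 'rV[R]_n -> 'rV[R]_n) :
  {within unit_cube R n, continuous f} ->
  (forall v, unit_cube R n v -> unit_cube R n (f v)) ->
  exists2 v, unit_cube R n v & f v = v.
Proof.
move=> /subspace_continuousP fc fK.
pose pt m (b : 'I_n -> nat) : 'rV[R]_n := \row_j ((b j)%:R / m.+1%:R).
pose s m (j : 'I_n) (b : 'I_n -> nat) :=
  (* The signs on the faces are prescribed; as f maps the cube into itself, a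
   coordinate 0 cannot decrease and a coordinate 1 cannot increase. *)
  (b j == 0%N) || (b j < m.+1)%N && (pt m b 0 j <= f (pt m b) 0 j).
have DPM m := @discrete_poincare_miranda n (s m) m.+1.
have ptK m b : (forall j, b j <= m.+1)%N -> unit_cube R n (pt m b).
  move=> bm j; rewrite mxE divr_ge0 ?ler0n//= ler_pdivrMr ?ltr0n// mul1r ler_nat.
  exact: bm.
have {DPM} step m : exists b : 'I_n -> nat, unit_cube R n (pt m b) /\
  forall j, exists p q,
   [/\ unit_cube R n p /\ unit_cube R n q, ball (pt m b) (2 / m.+1%:R) p,
       ball (pt m b) (2 / m.+1%:R) q, p 0 j <= f p 0 j & f q 0 j <= q 0 j].
  have [||b [bm bpq]] := DPM m.
  - by move=> j b b0; rewrite /s b0.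
  - by move=> j b bk; rewrite /s bk ltnn.
  exists b; split; first by apply: ptK => j; apply/ltnW/bm.
  move=> j; have [p [q [sp sq pb qb]]] := bpq j.
  have close c : (forall i, b i <= c i <= (b i).+1)%N ->
      unit_cube R n (pt m c) /\ ball (pt m b) (2 / m.+1%:R) (pt m c).
    move=> cb; split.
      by apply: ptK => i; have /andP[_ /leq_trans] := cb i; apply; exact: bm.
    split=> [|i0 i]; first by rewrite divr_gt0.
    rewrite ord1 /ball /= !mxE -mulrBl normrM [X in _ * X]gtr0_norm ?invr_gt0 ?ltr0n//.
    rewrite ltr_pM2r ?invr_gt0 ?ltr0n//; have /andP[b1 b2] := cb i.
    have : ((b i)%:R <= (c i)%:R :> R) by rewrite ler_nat.
    have : ((c i)%:R <= (b i)%:R + 1 :> R) by rewrite natr1 ler_nat.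
    by move=> h1 h2; rewrite ler0_norm; lra.
  have [pK pB] := close _ pb; have [qK qB] := close _ qb.
  exists (pt m p), (pt m q); split=> //.
  - have /orP[/eqP p0|/andP[//]] := sp.
    by rewrite {1}mxE p0 mul0r; case/andP: (fK _ pK j).
  - move: sq; rewrite /s negb_or negb_and -leqNgt -ltNge => /andP[_ /orP[mq|/ltW//]].
    have /andP[_ f1] := fK _ qK j; apply: le_trans f1 _.
    by rewrite mxE ler_pdivlMr ?ltr0n// mul1r ler_nat.
have [b bP] := choice step.
have ptbK : ((fun m => pt m (b m)) @ \oo) (unit_cube R n).
  by exists 0%N => // m _; exact: (bP m).1.
have [x [xK xcl]] := unit_cube_compact (fmap_proper_filter _ _) ptbK.
exists x => //; apply/rowP => j; apply/eqP; rewrite -subr_eq0.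
pose g y := f y 0 j - y 0 j.
have gc : g @ within (unit_cube R n) (nbhs x) --> g x.
  apply: cvgB.
    apply: (@cvg_comp _ _ _ f (fun M : 'rV[R]_n => M 0 j) _ (nbhs (f x)));
      first exact: fc.
    exact: coord_continuous.
  apply: cvg_within_filter; exact: coord_continuous.
have near_x P : (\forall y \near within (unit_cube R n) (nbhs x), P y) ->
   exists m, forall y, unit_cube R n y -> ball (pt m (b m)) (2 / m.+1%:R) y -> P y.
  move=> /nbhs_ballP[e /= e0 Pe].
  have e20 : 0 < e / 2 by rewrite divr_gt0.
  have [N _ Nle] : \forall m \near \oo, 2 / m.+1%:R < e / 2.
    near=> m; rewrite ltr_pdivrMr ?ltr0n// mulrC -ltr_pdivrMr//.
    apply: lt_trans (_ : m%:R < _); last by rewrite ltr_nat.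
    near: m; exact: nbhs_infty_gtr.
  have [||y [[m Nm <-] xm]] := xcl [set pt m (b m) | m in [set m | N <= m]%N] (ball x (e / 2)).
  - by exists N => // m /= Nm; exists m.
  - exact: nbhsx_ballx.
  exists m => z zK mz; apply: Pe => //; rewrite [e]splitr; apply: ball_triangle xm _.
  by apply: le_ball mz; apply/ltW/Nle.
rewrite -/(g x); have [gx|gx|//] := ltgtP (g x) 0.
- have [m mP] := near_x _ (cvgr_lt _ gc _ gx).
  have [p [q [[pK _] pB _ fp _]]] := (bP m).2 j.
  by have := mP p pK pB; rewrite /g subr_lt0 ltNge fp.
- have [m mP] := near_x _ (cvgr_gt _ gc _ gx).
  have [p [q [[_ qK] _ qB _ fq]]] := (bP m).2 j.
  by have := mP q qK qB; rewrite /g subr_gt0 ltNge fq.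
Unshelve. all: by end_near. Qed.

(** * The Schauder-Tychonoff fixed point theorem for real functions *)

Lemma near_all_seq (T : Type) (F : set_system T) (I : eqType) (S : seq I)
    (P : I -> T -> Prop) : Filter F ->
  (forall s, s \in S -> \near F, P s F) ->
  \forall t \near F, forall s, s \in S -> P s t.
Proof.
move=> FF; elim: S => [|s S IH] nP.
  by apply: filterE => t s; rewrite in_nil.
have PS : \forall t \near F, forall s, s \in S -> P s t.
  by apply: IH => s' s'S; apply: nP; rewrite inE s'S orbT.
apply: filterS2 (nP s (mem_head _ _)) PS => t Pst PSt s'.
by rewrite inE => /orP[/eqP ->|/PSt].
Qed.

Lemma ptws_cvg (X : Type) (U : topologicalType) (T : Type) (F : set_system T)
    (G : T -> {ptws X -> U}) (l : {ptws X -> U}) : Filter F ->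
  (forall x, (fun t => G t x) @ F --> l x) -> G @ F --> l.
Proof.
move=> FF Gl; apply/cvg_sup => x V [W] [[Q] oQ <-] QlX QW.
apply: (filterS QW); apply: (Gl x); exact: open_nbhs_nbhs.
Qed.

Lemma ptws_eval_cvg (X : eqType) (U : topologicalType) (l : {ptws X -> U}) x :
  (fun f : {ptws X -> U} => f x) @ l --> l x.
Proof. exact: (@proj_continuous X (fun=> U) x l). Qed.

Lemma dist_cvg (R : realType) (T : Type) (F : set_system T) (f g : T -> R) (l m : R) :
  Filter F -> f @ F --> l -> g @ F --> m -> (fun t => `|f t - g t|) @ F --> `|l - m|.
Proof. by move=> FF fl gm; apply: cvg_norm; apply: cvgB. Qed.

Lemma rV_cvg (R : realType) n (T : Type) (F : set_system T)
    (G : T -> 'rV[R]_n) (l : 'rV[R]_n) : Filter F ->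
  (forall j, (fun t => G t 0 j) @ F --> l 0 j) -> G @ F --> l.
Proof.
move=> FF Gl; apply/cvg_ballP => e e0; near=> t.
split=> // i j; rewrite ord1 {i}; move: j; near: t.
apply: filter_forall => j; exact: (cvg_ball (Gl j)).
Unshelve. all: by end_near. Qed.

Lemma pos_part_cvg (R : realType) (T : Type) (F : set_system T) (f : T -> R) (l : R) :
  Filter F -> f @ F --> l -> (fun t => Num.max 0 (f t)) @ F --> Num.max 0 l.
Proof.
move=> FF fl; apply: (cvg_comp f (fun r : R => Num.max 0 r) fl).
exact: (@continuous_max R R (fun=> 0) id l (cvg_cst _) cvg_id).
Qed.

Lemma prod_seq_cvg (R : realType) (T I : Type) (S : seq I) (F : set_system T)
    (f : I -> T -> R) (l : I -> R) : Filter F ->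
  (forall s, f s @ F --> l s) ->
  (fun t => \prod_(s <- S) f s t) @ F --> \prod_(s <- S) l s.
Proof.
move=> FF fl; elim: S => [|s S IH].
  by under eq_fun do rewrite big_nil; rewrite big_nil; exact: cvg_cst.
by under eq_fun do rewrite big_cons; rewrite big_cons; exact: cvgM.
Qed.

Definition convex_family (R : realType) (X : Type) (K : set (X -> R)) :=
  forall f g t, K f -> K g -> 0 <= t <= 1 -> K (fun x => t * f x + (1 - t) * g x).

Lemma convex_family_sum (R : realType) (X : Type) (K : set (X -> R)) N
    (w : 'I_N -> R) (y : 'I_N -> X -> R) : convex_family K ->
  (forall i, 0 <= w i) -> \sum_i w i = 1 -> (forall i, K (y i)) ->
  K (fun x => \sum_i w i * y i x).
Proof.
move=> Kc; elim: N w y => [w y _|N IH w y w0 w1 yK].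
  by rewrite big_ord0 => /eqP; rewrite eq_sym oner_eq0.
have w1' : \sum_(i < N) w (lift ord0 i) = 1 - w ord0.
  by rewrite -w1 big_ord_recl addrC addKr.
have [w01|w01] := eqVneq (w ord0) 1.
  have wl i : w (lift ord0 i) = 0.
    apply/eqP; rewrite eq_le w0 andbT -{1}(subrr (1 : R)) -{2}w01 -w1'.
    by rewrite (bigD1 i) //= lerDl; exact: sumr_ge0.
  rewrite (_ : (fun x => _) = y ord0) //; apply/funext => x.
  by rewrite big_ord_recl w01 mul1r big1 ?addr0// => i _; rewrite wl mul0r.
have lt1 : 0 < 1 - w ord0.
  by rewrite lt_def subr_eq0 eq_sym w01 -w1'; exact: sumr_ge0.
have := Kc (y ord0) (fun x => \sum_i (w (lift ord0 i) / (1 - w ord0)) * y (lift ord0 i) x) (w ord0).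
rewrite (_ : (fun x => _ + _) = (fun x => \sum_i w i * y i x)); last first.
  apply/funext => x; rewrite big_ord_recl mulr_sumr; congr (_ + _).
  apply: eq_bigr => i _; rewrite mulrA; congr (_ * _).
  by rewrite mulrC divfK// gt_eqF.
apply=> //; last by rewrite w0 /= -subr_ge0 ltW.
apply: IH => // [i|].
  by rewrite divr_ge0// ltW.
by rewrite -mulr_suml w1' divff// gt_eqF.
Qed.

(** The covering form of compactness is stated for pointed spaces. *)
HB.instance Definition _ (X : Type) (U : X -> ptopologicalType) :=
  isPointed.Build (prod_topology U) (fun x => point).

Section SchauderTychonoff.
Variables (R : realType) (X : eqType) (K : set {ptws X -> R}).
Variable A : {ptws X -> R} -> {ptws X -> R}.
Hypotheses (K0 : K !=set0) (Kcompact : compact K) (Kconvex : convex_family K).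
Hypotheses (AK : forall f, K f -> K (A f)) (Acont : {within K, continuous A}).

(** Compactness for pointwise convergence makes [K] totally bounded for the
    uniform distance on a finite set [S] of points. *)
Lemma finite_net (S : seq X) (e : R) : 0 < e -> exists N (y : 'I_N -> X -> R),
  (forall i, K (y i)) /\
  forall f, K f -> exists i, forall s, s \in S -> `|f s - y i s| < e.
Proof.
move=> e0; pose U (g : {ptws X -> R}) : set {ptws X -> R} :=
  [set f | forall s, s \in S -> `|f s - g s| < e].
have Uopen g : K g -> open (U g).
  move=> _; rewrite openE => f Uf.
  apply: (@near_all_seq _ (nbhs f) _ _ (fun s (h : {ptws X -> R}) => `|h s - g s| < e)) => s sS.
  have fs : (fun h : {ptws X -> R} => `|h s - g s|) @ f --> `|f s - g s|.
    exact: dist_cvg (@ptws_eval_cvg X R f s) (cvg_cst (g s)).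
  exact: (cvgr_lt _ fs _ (Uf s sS)).
have Kcov : K `<=` cover K U.
  by move=> f Kf; exists f => // s _; rewrite subrr normr0.
have := Kcompact; rewrite compact_cover => /(_ _ _ _ Uopen Kcov)[D DK Dcov].
exists (size D), (fun i => nth (fun=> 0) D i); split.
  by move=> i; exact: set_mem (DK _ (mem_nth (fun=> 0) (ltn_ord i))).
move=> f /Dcov[g /= gD Ug]; have gi : (index g D < size D)%N by rewrite index_mem.
by exists (Ordinal gi) => s sS /=; rewrite nth_index//; exact: Ug.
Qed.

(** The Schauder projection: [y i] receives the weight [mu i], which is positive
    only within [e] of [y i] on [S], so that averaging the [y i] with the
    normalised weights of [A f] moves [A f] by at most [e] on [S].  On weights
    the composed map is a continuous self-map of a cube, and Brouwer applies. *)
Lemma almost_fixed (S : seq X) (e : R) : 0 < e ->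
  exists2 f, K f & forall s, s \in S -> `|A f s - f s| <= e.
Proof.
move=> e0; have [N [y [yK ynet]]] := finite_net S e0.
have N0 : (0 < N)%N.
  by have [f /ynet[i _]] := K0; case: (N) i => // -[].
pose mu i (f : {ptws X -> R}) := \prod_(s <- S) Num.max 0 (e - `|f s - y i s|).
have mu_ge0 i f : 0 <= mu i f by apply: prodr_ge0 => s _; rewrite le_max lexx.
have mu_pos f : K f -> 0 < \sum_i mu i f.
  move=> /ynet[i fi]; rewrite (bigD1 i)//= ltr_wpDr ?sumr_ge0//.
  rewrite /mu big_seq; apply: prodr_gt0 => s /fi; rewrite -subr_gt0 => h.
  by rewrite lt_max h orbT.
have mu_near i f s : mu i f != 0 -> s \in S -> `|f s - y i s| < e.
  move=> + sS; rewrite /mu (big_rem s)//= mulf_eq0 negb_or => /andP[+ _].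
  by rewrite ltNge; apply: contraNN => h; rewrite max_l// subr_le0.
pose sg (v : 'rV[R]_N) := \sum_i v 0 i.
pose z v := Num.max 0 (1 - sg v).
(* A vector of the cube need not have sum 1: when the sum is less than 1 the
   defect is spread evenly, when it is larger the vector is rescaled.  Both
   corrections are trivial at a fixed point, where the sum is 1. *)
pose W i (v : 'rV[R]_N) := (v 0 i + z v / N%:R) / (sg v + z v).
have z0 v : 0 <= z v by rewrite le_max lexx.
have den v : 0 < sg v + z v.
  rewrite /z maxEge; case: ifP => h; lra.
have W0 v : unit_cube R N v -> forall i, 0 <= W i v.
  move=> vK i; have /andP[v0 _] := vK i.
  by rewrite divr_ge0// ?(ltW (den v))// addr_ge0// divr_ge0.
have W1 v : \sum_i W i v = 1.
  rewrite -mulr_suml big_split /= -/(sg v) sumr_const card_ord -[_ *+ N]mulr_natr.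
  by rewrite divfK ?pnatr_eq0 -?lt0n// divff// gt_eqF.
pose Phi (v : 'rV[R]_N) : {ptws X -> R} := fun x => \sum_i W i v * y i x.
have PhiK v : unit_cube R N v -> K (Phi v).
  by move=> vK; apply: (convex_family_sum Kconvex) => //; exact: W0.
pose B v := \row_i (mu i (A (Phi v)) / \sum_k mu k (A (Phi v))).
have BK v : unit_cube R N v -> unit_cube R N (B v).
  move=> /PhiK/AK/mu_pos mupos i; rewrite mxE divr_ge0 ?(ltW mupos)//=.
  by rewrite ler_pdivrMr// mul1r (bigD1 i)//= lerDl sumr_ge0.
have Bc : {within unit_cube R N, continuous B}.
  apply/subspace_continuousP => v vK.
  have coordc i : (fun v : 'rV[R]_N => v 0 i) @ within (unit_cube R N) (nbhs v) --> v 0 i.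
    apply: cvg_within_filter; exact: coord_continuous.
  have sgc : sg @ within (unit_cube R N) (nbhs v) --> sg v.
    by apply: (cvg_big (op := +%R) add_continuous) => i _; exact: coordc.
  have zc : z @ within (unit_cube R N) (nbhs v) --> z v.
    by apply: pos_part_cvg; apply: cvgB => //; exact: cvg_cst.
  have Wc i : W i @ within (unit_cube R N) (nbhs v) --> W i v.
    apply: cvgM; first by apply: cvgD; [exact: coordc|apply: cvgM => //;
      exact: cvg_cst].
    by apply: cvgV; [rewrite gt_eqF|exact: cvgD].
  have Phic : Phi @ within (unit_cube R N) (nbhs v) --> within K (nbhs (Phi v)).
    have PhiC : Phi @ within (unit_cube R N) (nbhs v) --> (Phi v : {ptws X -> R}).
      apply: ptws_cvg => x; apply: (cvg_big (op := +%R) add_continuous) => i _.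
      by apply: cvgM; [exact: Wc|exact: cvg_cst].
    move=> Q KQ; have := PhiC _ KQ; rewrite /= /nbhs /= => PQ.
    have := withinT (unit_cube R N) (nbhs_filter v) => Kw.
    by apply: filterS2 Kw PQ => w /PhiK Kw; exact.
  have AP : (fun v => A (Phi v)) @ within (unit_cube R N) (nbhs v) --> A (Phi v).
    apply: cvg_comp Phic _; move/subspace_continuousP : Acont; apply; exact: PhiK.
  have muc i : (fun v => mu i (A (Phi v))) @ within (unit_cube R N) (nbhs v) --> mu i (A (Phi v)).
    apply: prod_seq_cvg => s; apply: pos_part_cvg; apply: cvgB; first exact: cvg_cst.
    apply: dist_cvg (cvg_cst _); exact: (cvg_comp _ _ AP (@ptws_eval_cvg X R _ s)).
  apply: rV_cvg => j; rewrite [X in _ --> X]mxE; under eq_fun do rewrite mxE.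
  apply: cvgM => //; apply: cvgV; first by rewrite gt_eqF// mu_pos//; exact/AK/PhiK.
  by apply: (cvg_big (op := +%R) add_continuous) => i _.
have [v vK Bv] := brouwer_unit_cube Bc BK.
have mupos := mu_pos _ (AK (PhiK _ vK)).
have vE i : v 0 i = mu i (A (Phi v)) / \sum_k mu k (A (Phi v)).
  by rewrite -[in LHS]Bv mxE.
have sg1 : sg v = 1.
  by rewrite /sg; under eq_bigr do rewrite vE; rewrite -mulr_suml divff// gt_eqF.
have WE i : W i v = v 0 i.
  by rewrite /W /z sg1 subrr maxxx mul0r !addr0 divr1.
exists (Phi v); first exact: PhiK.
move=> s sS; rewrite {2}/Phi -[A _ s]mul1r -{1}(W1 v) mulr_suml -sumrB.
apply: le_trans (ler_norm_sum _ _ _) _.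
rewrite -[leRHS]mul1r -(W1 v) mulr_suml; apply: ler_sum => i _.
rewrite -mulrBr normrM ger0_norm ?W0//; have [->|Wn0] := eqVneq (W i v) 0.
  by rewrite !mul0r.
rewrite ler_wpM2l ?W0//; apply/ltW/mu_near => //.
by apply: contra_neq Wn0 => mu0; rewrite WE vE mu0 mul0r.
Qed.

(** Without a fixed point, every [f] in [K] is moved by a positive amount at
    some point of [X], and so are its neighbours; by compactness finitely many
    points of [X] and one positive amount suffice, against [almost_fixed]. *)
Theorem schauder_tychonoff : exists2 f, K f & A f = f.
Proof.
apply: contrapT => nofix.
have /choice[s sP] : forall f : {ptws X -> R}, exists s, K f -> A f s != f s.
  move=> f; have [Kf|nKf] := pselect (K f); last first.
    have [s|noX] := pselect (exists s : X, True).
      by case: s => s _; exists s.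
    case: nofix; have [g Kg] := K0; exists g => //; apply/funext => x.
    by case: noX; exists x.
  apply: contrapT => /forallNP all_eq; apply: nofix; exists f => //.
  apply/funext => x; have := all_eq x; rewrite not_implyE => -[_ /negP].
  by rewrite negbK => /eqP.
pose e f := `|A f (s f) - f (s f)| / 2.
have epos f : K f -> 0 < e f.
  by move=> Kf; rewrite divr_gt0// normr_gt0 subr_eq0 sP.
pose V f : set {ptws X -> R} := [set g | K g -> e f < `|A g (s f) - g (s f)|].
have Vnbhs f : K f -> nbhs f (V f).
  move=> Kf; have Ac : (fun g => `|A g (s f) - g (s f)|) @ within K (nbhs f) -->
      `|A f (s f) - f (s f)|.
    apply: dist_cvg; last first.
      apply: cvg_within_filter; exact: (@ptws_eval_cvg X R).
    apply: (@cvg_comp _ _ _ A (fun g : {ptws X -> R} => g (s f)) _ (nbhs (A f))).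
      by move/subspace_continuousP : Acont; apply.
    exact: (@ptws_eval_cvg X R).
  apply: (cvgr_gt _ Ac); rewrite /e ltr_pdivrMr// ltr_pMr ?ltr1n//.
  by rewrite normr_gt0 subr_eq0 sP.
have Vopen f : K f -> open (V f)° by move=> _; exact: open_interior.
have Kcov : K `<=` cover K (fun f => (V f)°) by move=> f Kf; exists f => //;
  exact: Vnbhs.
have := Kcompact; rewrite compact_cover => /(_ _ _ _ Vopen Kcov)[D DK Dcov].
have [d d0 dle] : exists2 d, 0 < d & forall f, f \in (D : seq _) -> d <= e f.
  have : forall f, f \in (D : seq _) -> 0 < e f by move=> f fD; exact/epos/set_mem/DK.
  elim: (D : seq _) => [_|f D' IH De]; first by exists 1; [exact: ltr01|].
  have [g gD|d d0 dle] := IH; first by apply: De; rewrite inE gD orbT.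
  exists (Num.min d (e f)); first by rewrite lt_min d0 De ?mem_head.
  move=> g; rewrite inE => /orP[/eqP ->|/dle dg]; first by rewrite ge_min lexx orbT.
  by rewrite ge_min dg.
have [f Kf fS] := almost_fixed [seq s f | f <- D] d0.
have [g /= gD /interior_subset] := Dcov f Kf.
move=> /(_ Kf); rewrite ltNge => /negP; apply.
apply: le_trans (dle g gD); apply: fS.
exact: map_f.
Qed.

End SchauderTychonoff.

(** * Delta derivatives on a periodic time scale *)

Lemma near_distP (R : realType) (t : R) (P : R -> Prop) :
  (\forall s \near t, P s) <-> exists2 d, 0 < d & forall s, `|s - t| < d -> P s.
Proof.
split=> [/nbhs_ballP[d /= d0 dP]|[d d0 dP]].
  by exists d => // s st; apply: dP; rewrite /ball /= distrC.
by apply/nbhs_ballP; exists d => // s; rewrite /ball /= distrC; exact: dP.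
Qed.

Lemma closed_sup (R : realType) (A : set R) : closed A -> has_sup A -> A (sup A).
Proof.
move=> Acl Asup; apply: Acl => B /near_distP[d d0 dB].
have [s As sd] := sup_adherent d0 Asup; exists s; split=> //; apply: dB.
have sle : s <= sup A by apply: ub_le_sup => //; exact: Asup.2.
by rewrite ler0_norm; lra.
Qed.

Section TimeScale.
Variables (R : realType) (T : R) (TS : set R).
Hypotheses (T_gt0 : 0 < T) (TScl : closed TS) (TS0 : TS 0).
Hypothesis TSper : forall s, TS (s + T) <-> TS s.

Local Notation sigma := (forward_jump TS).

Lemma TS_addn s k : TS (s + T *+ k) <-> TS s.
Proof.
elim: k => [|k IH]; first by rewrite mulr0n addr0.
by rewrite mulrSr addrA TSper.
Qed.

Lemma TS_subn s k : TS (s - T *+ k) <-> TS s.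
Proof. by rewrite -(TS_addn _ k) subrK. Qed.

Lemma ex_mulT (b : R) : exists k, b < T *+ k.
Proof.
have [k _ /(_ k (leqnn _)) /= bk] : \forall m \near \oo, b / T < m%:R.
  exact: nbhs_infty_gtr.
by exists k; rewrite -mulr_natl mulrC -ltr_pdivrMl// mulrC.
Qed.

Lemma jump_set_inf t : has_inf [set s | TS s /\ t < s].
Proof.
split; last by exists t => s [_ /ltW].
have [k tk] := ex_mulT t; exists (T *+ k); split=> //.
by rewrite -[T *+ k]add0r; apply/TS_addn.
Qed.

Lemma le_sigma t : t <= sigma t.
Proof. by apply: lb_le_inf => [|s [_ /ltW//]]; exact: (jump_set_inf t).1. Qed.

Lemma sigma_le t s : TS s -> t < s -> sigma t <= s.
Proof. by move=> TSs ts; apply: ge_inf => //; exact: (jump_set_inf t).2. Qed.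

Lemma sigma_adherent t e : 0 < e -> exists s, [/\ TS s, t < s & s < sigma t + e].
Proof.
by move=> e0; have [s [TSs ts] se] := inf_adherent e0 (jump_set_inf t); exists s.
Qed.

Lemma TS_sigma t : TS t -> TS (sigma t).
Proof.
move=> TSt; apply: TScl => B /near_distP[d d0 dB].
have [s [TSs ts sd]] := sigma_adherent t d0; exists s; split=> //; apply: dB.
by have := sigma_le TSs ts => sle; rewrite ger0_norm; lra.
Qed.

(** Uniqueness of the delta derivative needs points that make the increment
    sigma t - s nonzero: t itself if t is right-scattered, and points of TS just
    above t otherwise. *)
Lemma near_not_sigma t (P : R -> Prop) : TS t -> (\forall s \near t, P s) ->
  exists s, [/\ TS s, P s & sigma t - s != 0].
Proof.
move=> TSt /near_distP[d d0 dP]; have := le_sigma t.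
rewrite le_eqVlt => /orP[/eqP tE|tlt]; last first.
  by exists t; split=> //; [apply: dP; rewrite subrr normr0|rewrite subr_eq0 gt_eqF].
have [s [TSs ts sd]] := sigma_adherent t d0; exists s; split=> //.
  by apply: dP; rewrite ger0_norm; lra.
by rewrite subr_eq0 -tE lt_eqF.
Qed.

Lemma delta_unique x t l m : TS t ->
  is_delta_derive TS x t l -> is_delta_derive TS x t m -> l = m.
Proof.
move=> TSt xl xm; apply/eqP; rewrite -subr_eq0 -normr_eq0.
have [//|n0] := eqVneq `|l - m| 0.
have e0 : 0 < `|l - m| / 3 by rewrite divr_gt0// lt_def n0 normr_ge0.
have [s [TSs [/(_ TSs) A /(_ TSs) B] s0]] :=
  near_not_sigma TSt (filterI (xl _ e0) (xm _ e0)).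
have : `|l - m| * `|sigma t - s| <= `|l - m| / 3 * `|sigma t - s| + `|l - m| / 3 * `|sigma t - s|.
  rewrite -normrM; apply: le_trans (lerD B A); apply: le_trans (ler_normB _ _).
  by rewrite le_eqVlt; apply/orP; left; apply/eqP; congr `|_|; ring.
rewrite -mulrDl ler_pM2r ?normr_gt0//; move: e0; lra.
Qed.

Lemma delta_deriveE x t l : TS t -> is_delta_derive TS x t l ->
  delta_derive TS x t = l.
Proof.
move=> TSt xl; rewrite /delta_derive; case: xgetP => [m _ xm|/(_ l)//].
exact: delta_unique xm xl.
Qed.

Lemma eq_delta x y t l : TS t -> (forall s, TS s -> x s = y s) ->
  is_delta_derive TS x t l -> is_delta_derive TS y t l.
Proof.
move=> TSt xy xl e /xl; apply: filterS => s + TSs => /(_ TSs).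
by rewrite !xy//; exact: TS_sigma.
Qed.

Lemma delta_add x y t l m : is_delta_derive TS x t l -> is_delta_derive TS y t m ->
  is_delta_derive TS (fun s => x s + y s) t (l + m).
Proof.
move=> xl ym e e0; have e20 : 0 < e / 2 by rewrite divr_gt0.
apply: filterS2 (xl _ e20) (ym _ e20) => s + + TSs => /(_ TSs) A /(_ TSs) B.
rewrite [X in _ <= X * _](splitr e) [leRHS]mulrDl; apply: le_trans (lerD A B).
by apply: le_trans (ler_normD _ _); rewrite le_eqVlt; apply/orP; left; apply/eqP;
  congr `|_|; ring.
Qed.

Lemma delta_scale x t l c : is_delta_derive TS x t l ->
  is_delta_derive TS (fun s => c * x s) t (c * l).
Proof.
move=> xl e e0; have c0 : 0 < `|c| + 1 by rewrite ltr_wpDl.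
have e20 : 0 < e / (`|c| + 1) by rewrite divr_gt0.
apply: filterS (xl _ e20) => s + TSs => /(_ TSs) A.
rewrite (_ : _ - _ = c * (x (sigma t) - x s - l * (sigma t - s))); last by ring.
rewrite normrM; apply: le_trans (ler_wpM2l (normr_ge0 _) A) _.
rewrite mulrA ler_wpM2r// mulrCA ger_pMr// ler_pdivrMr// mul1r lerDl//.
Qed.

Lemma delta_cst c t : is_delta_derive TS (fun=> c) t 0.
Proof.
move=> e e0; near=> s => _; rewrite subrr mul0r subr0 normr0.
by rewrite mulr_ge0// ltW.
Unshelve. all: by end_near. Qed.

Lemma delta_id t : is_delta_derive TS id t 1.
Proof.
move=> e e0; near=> s => _; rewrite mul1r subrr normr0.
by rewrite mulr_ge0// ltW.
Unshelve. all: by end_near. Qed.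

Lemma sigma_shift c t : (forall s, TS (s + c) <-> TS s) -> sigma (t + c) = sigma t + c.
Proof.
move=> TSc; apply/eqP; rewrite eq_le; apply/andP; split.
  rewrite -lerBlDr; apply: lb_le_inf; first exact: (jump_set_inf t).1.
  move=> s [TSs ts]; rewrite lerBlDr; apply: sigma_le; first exact/TSc.
  by rewrite ltrD2r.
apply: lb_le_inf; first exact: (jump_set_inf _).1.
move=> s [TSs ts]; rewrite -lerBrDr; apply: sigma_le; last by rewrite ltrBrDr.
by apply/TSc; rewrite subrK.
Qed.

Lemma delta_shift c x t l : (forall s, TS (s + c) <-> TS s) ->
  is_delta_derive TS x (t + c) l -> is_delta_derive TS (fun s => x (s + c)) t l.
Proof.
move=> TSc xl e /xl/near_distP[d d0 dP]; apply/near_distP; exists d => // s st TSs.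
have := dP (s + c); rewrite sigma_shift// (_ : s + c - (t + c) = s - t); last by ring.
move=> /(_ st); rewrite (_ : sigma t + c - (s + c) = sigma t - s); last by ring.
by apply; exact/TSc.
Qed.

(** The definition at s = t, for all tolerances, forces x (sigma t) - x t to be
    exactly l * (sigma t - t); the estimate at s then compares x s with x t. *)
Lemma delta_continuous x t l e : TS t -> is_delta_derive TS x t l -> 0 < e ->
  \forall s \near t, TS s -> `|x s - x t| < e.
Proof.
move=> TSt xl e0; set d := sigma t - t.
have d0 : 0 <= d by rewrite subr_ge0 le_sigma.
have xt0 : x (sigma t) - x t = l * d.
  apply/eqP; rewrite -subr_eq0 -normr_le0; apply/ler_addgt0Pr => k k0.
  have d10 : 0 < d + 1 by rewrite ltr_wpDl.
  have /nbhs_singleton/(_ TSt) := xl _ (divr_gt0 k0 d10).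
  move/le_trans; apply; rewrite add0r (ger0_norm d0) mulrAC ler_pdivrMr//.
  by rewrite ler_pM2l// lerDl.
have k0 : 0 < Num.min 1 (e / 2 / (d + 1)) by rewrite lt_min ltr01 !divr_gt0// ltr_wpDl.
have [r r0 rP] := (near_distP _ _).1 (xl _ k0).
apply/near_distP; exists (Num.min r (Num.min 1 (e / 2 / (`|l| + 1)))).
  by rewrite !lt_min r0 ltr01 !divr_gt0// ltr_wpDl.
move=> s; rewrite !lt_min => /and3P[sr s1 sl] TSs.
have A := rP s sr TSs.
rewrite (_ : x s - x t = l * (s - t) - (x (sigma t) - x s - l * (sigma t - s)));
  last first.
  have -> : x s - x t = x s - x (sigma t) + (x (sigma t) - x t) by ring.
  by rewrite xt0 /d; ring.
apply: le_lt_trans (ler_normB _ _) _; rewrite [ltRHS]splitr; apply: ltr_leD.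
  rewrite normrM; apply: le_lt_trans (_ : (`|l| + 1) * `|s - t| < _).
    by rewrite ler_wpM2r// lerDl.
  by rewrite mulrC -ltr_pdivlMr// ltr_wpDl.
apply: le_trans A _; apply: le_trans (_ : e / 2 / (d + 1) * `|sigma t - s| <= _).
  by rewrite ler_wpM2r// ge_min lexx orbT.
rewrite mulrAC ler_pdivrMr ?ltr_wpDl// ler_pM2l ?divr_gt0//.
rewrite (_ : sigma t - s = d + (t - s)); last by rewrite /d; ring.
by apply: le_trans (ler_normD _ _) _; rewrite ger0_norm// lerD2l distrC ltW.
Qed.

(** With the slope B + e for an arbitrary e > 0, let c be the infimum of the
    points violating the inequality.  The inequality holds at c: by continuity
    if c is left-dense, by the derivative at the predecessor of c if it is
    left-scattered.  As violations accumulate at c from the right, c is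
    right-dense, and there the derivative at c excludes them. *)
Lemma delta_mean_value F f B s t : (forall u, TS u -> is_delta_derive TS F u (f u)) ->
  (forall u, TS u -> f u <= B) -> TS s -> TS t -> s <= t ->
  F t - F s <= B * (t - s).
Proof.
move=> Ff fB TSs TSt st; apply/ler_addgt0Pr => e' e'0.
pose e := e' / (t - s + 1).
have ts1 : 0 < t - s + 1 by rewrite ltr_wpDl// subr_ge0.
have e0 : 0 < e by rewrite divr_gt0.
suff : F t - F s <= (B + e) * (t - s).
  move/le_trans; apply; rewrite mulrDl lerD2l /e mulrAC ler_pdivrMr//.
  by rewrite ler_pM2l// lerDl.
pose S := [set u | [/\ TS u, s <= u & (B + e) * (u - s) < F u - F s]].
rewrite leNgt; apply/negP => tS.
have Sinf : has_inf S by split; [exists t|exists s => u []].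
pose c := inf S.
have sc : s <= c by apply: lb_le_inf => [|u []//]; exact: Sinf.1.
have TSc : TS c.
  apply: TScl => V /near_distP[d d0 dV].
  have [u uS ud] := inf_adherent d0 Sinf; exists u; split; first by case: uS.
  have cu : c <= u by apply: ge_inf => //; exact: Sinf.2.
  by apply: dV; rewrite ger0_norm; move: cu ud; rewrite /c; lra.
have below u : TS u -> s <= u -> u < c -> F u - F s <= (B + e) * (u - s).
  move=> TSu su uc; rewrite leNgt; apply/negP => uS.
  by move: uc; rewrite ltNge => /negP; apply; apply: ge_inf; [exact: Sinf.2|].
have atc : F c - F s <= (B + e) * (c - s).
  move: sc; rewrite le_eqVlt => /orP[/eqP <-|sc]; first by rewrite !subrr mulr0.
  rewrite leNgt; apply/negP => cS.
  pose P := [set u | TS u /\ u < c].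
  have Psup : has_sup P by split; [exists s|exists c => u [_ /ltW]].
  (* r is the predecessor of c in TS, or c itself when c is left-dense. *)
  pose r := sup P.
  have rc : r <= c by apply: ge_sup => [|u [_ /ltW//]]; exact: Psup.1.
  have sr : s <= r by apply: ub_le_sup; [exact: Psup.2|].
  have Pr u : TS u -> u < c -> u <= r by move=> *; apply: ub_le_sup; [exact: Psup.2|].
  move: rc; rewrite le_eqVlt => /orP[/eqP rE|rc].
    pose k := (F c - F s - (B + e) * (c - s)) / 2.
    have k0 : 0 < k by rewrite divr_gt0// subr_gt0.
    have [d d0 dP] := (near_distP _ _).1 (delta_continuous TSc (Ff c TSc) k0).
    pose d' := Num.min (Num.min d (c - s)) (k / (`|B + e| + 1)).
    have d'0 : 0 < d' by rewrite !lt_min d0 subr_gt0 sc divr_gt0// ltr_wpDl.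
    have [u [TSu uc] ur] := sup_adherent d'0 Psup.
    have : c - u < d' by move: ur; rewrite -/r rE; lra.
    rewrite !lt_min => /andP[/andP[ud us] uk].
    have := below u TSu _ uc => /(_ ltac:(lra)).
    have := dP u _ TSu => /(_ ltac:(by rewrite ltr0_norm; lra)).
    have : - (B + e) * (c - u) < k.
      apply: le_lt_trans (ler_norm _) _; rewrite normrM normrN.
      apply: le_lt_trans (_ : (`|B + e| + 1) * (c - u) < _); last first.
        by rewrite mulrC -ltr_pdivlMr// ltr_wpDl.
      by rewrite [ `|c - u|]gtr0_norm ?subr_gt0// ler_wpM2r ?lerDl// subr_ge0 ltW.
    rewrite ltr_norml /k => h1 /andP[h2 h3] h4; move: h1 h2 h4; lra.
  have TSr : TS r.
    apply: TScl => V /near_distP[d d0 dV].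
    have [u [TSu uc] ur] := sup_adherent d0 Psup; exists u; split=> //.
    have ur' := Pr _ TSu uc.
    by apply: dV; rewrite ler0_norm; move: ur ur'; rewrite /r; lra.
  have sigr : sigma r = c.
    apply/eqP; rewrite eq_le sigma_le//=; apply: lb_le_inf;
      first exact: (jump_set_inf r).1.
    by move=> u [TSu ru]; rewrite leNgt; apply/negP => /(Pr _ TSu); rewrite leNgt ru.
  have /nbhs_singleton/(_ TSr) := Ff r TSr _ e0.
  have fr := fB r TSr; have := below r TSr sr rc.
  rewrite sigr [ `|c - r|]gtr0_norm ?subr_gt0// => h1 /(le_trans (ler_norm _)) h2.
  have : f r * (c - r) <= B * (c - r) by rewrite ler_wpM2r// subr_ge0 ltW.
  by move: cS h1 h2; lra.
have [d d0 dP] := (near_distP _ _).1 (Ff c TSc _ e0).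
have near_c k : 0 < k -> exists u, [/\ S u, c < u & u < c + k].
  move=> k0; have [u uS ud] := inf_adherent k0 Sinf; exists u; split=> //.
  rewrite lt_def ge_inf ?andbT//; last exact: Sinf.2.
  by apply: contraPneq uS => ->; rewrite /S /= -/c => -[_ _]; rewrite ltNge atc.
have sigc : sigma c = c.
  apply/eqP; rewrite eq_le le_sigma andbT; apply/ler_addgt0Pr => k k0.
  have [u [[TSu _ _] cu uk]] := near_c k k0.
  exact: le_trans (sigma_le TSu cu) (ltW uk).
have [u [[TSu su uS] cu uk]] := near_c d d0.
have := dP u _ TSu => /(_ ltac:(by rewrite gtr0_norm; lra)).
rewrite sigc distrC [ `|c - u|]distrC [ `|u - c|]gtr0_norm ?subr_gt0//.
move=> /(le_trans (ler_norm _)) h.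
have : f c * (u - c) <= B * (u - c) by rewrite ler_wpM2r ?fB// subr_ge0 ltW.
by move: atc uS h; lra.
Qed.

End TimeScale.

(** * Existence of delta primitives *)

Lemma within_continuousP (R : realType) (A : set R) (f : R -> R) :
  {within A, continuous f} <->
  forall t, A t -> forall e, 0 < e -> \forall s \near t, A s -> `|f s - f t| < e.
Proof.
rewrite subspace_continuousP; split=> [fc t At e e0|fc t At].
  have ft : f @ within A (nbhs t) --> f t := fc t At.
  have : \forall s \near t, A s -> `|f t - f s| < e by exact: (cvgrPdist_lt _ _).1 ft e e0.
  by apply: filterS => s + As => /(_ As); rewrite distrC.
suff : f @ within A (nbhs t) --> f t by [].
apply/cvgrPdist_lt => e e0; apply: filterS (fc t At e e0) => s + As => /(_ As).
by rewrite distrC.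
Qed.

Lemma within_continuous_eq (R : realType) (A : set R) (f1 f2 : R -> R) :
  (forall t, A t -> f1 t = f2 t) -> {within A, continuous f1} -> {within A, continuous f2}.
Proof.
move=> f12 /within_continuousP fc; apply/within_continuousP => t At e e0.
by apply: filterS (fc t At e e0) => s + As; rewrite -!f12//; exact.
Qed.

Section Antiderivative.
Variables (R : realType) (T : R) (TS : set R).
Hypotheses (T_gt0 : 0 < T) (TScl : closed TS) (TS0 : TS 0).
Hypothesis TSper : forall s, TS (s + T) <-> TS s.

Local Notation sigma := (forward_jump TS).
Local Notation mu := (@lebesgue_measure R).

(** Composition with this projection extends a function on TS to the line by a
    constant on each gap (t, sigma t); its Lebesgue integral is then the delta
    integral. *)
Definition backward_proj (s : R) := sup [set u | TS u /\ u <= s].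
Local Notation fl := backward_proj.

Lemma backward_set_sup s : has_sup [set u | TS u /\ u <= s].
Proof.
split; last by exists s => u [].
have [k sk] := ex_mulT T_gt0 (- s); exists (0 - T *+ k); split.
  exact/(TS_subn TSper).
by rewrite sub0r lerNl ltW.
Qed.

Lemma backward_proj_le s : fl s <= s.
Proof. by apply: ge_sup => [|u []//]; exact: (backward_set_sup s).1. Qed.

Lemma le_backward_proj s u : TS u -> u <= s -> u <= fl s.
Proof. by move=> TSu us; apply: ub_le_sup; [exact: (backward_set_sup s).2|]. Qed.

Lemma TS_backward_proj s : TS (fl s).
Proof.
apply: TScl => V /near_distP[d d0 dV].
have [u [TSu us] ud] := sup_adherent d0 (backward_set_sup s).
exists u; split=> //; apply: dV.
have := le_backward_proj TSu us; move: ud; rewrite -/(fl s) => h1 h2.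
by rewrite ler0_norm; lra.
Qed.

Lemma backward_proj_homo : nondecreasing_fun fl.
Proof.
move=> s t st; apply: le_backward_proj; first exact: TS_backward_proj.
exact: le_trans (backward_proj_le s) st.
Qed.

Variables (f : R -> R) (B : R).
Hypotheses (fcont : {within TS, continuous f}) (fB : forall t, TS t -> `|f t| <= B).

Lemma step_integrable (a b : R) : mu.-integrable `[a, b[ (EFin \o (f \o fl)).
Proof.
apply: measurable_bounded_integrable => //.
- by rewrite /= lebesgue_measure_itv; case: ifP => _; rewrite ?ltry// -EFinB ltry.
- apply: measurable_funTS; apply: (measurable_comp (F := TS)).
  + exact: closed_measurable.
  + by move=> _ [s _ <-]; exact: TS_backward_proj.
  + by apply: subspace_continuous_measurable_fun fcont; exact: closed_measurable.
  + exact: nondecreasing_measurable backward_proj_homo.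
- exists B; split; first exact: num_real.
  by move=> M BM s _ /=; apply: le_trans (ltW BM); exact/fB/TS_backward_proj.
Qed.

Let I (a b : R) := \int[mu]_(s in `[a, b[) (f (fl s)).

Lemma step_integralD a b c : a <= b -> b <= c -> I a c = I a b + I b c.
Proof.
move=> ab bc; rewrite /I -Rintegral_setU//.
- by rewrite -itv_bndbnd_setU// bnd_simp.
- rewrite -itv_bndbnd_setU ?bnd_simp//; exact: step_integrable.
- by rewrite disj_set2E; apply/eqP/seteqP; split=> // s /= [];
    rewrite !in_itv/= => /andP[_ sb] /andP[bs _]; move: sb; rewrite ltNge bs.
Qed.

(** The half-open interval matters: the step function equals f t on
    [t, sigma t), but f (sigma t) at sigma t. *)
Lemma step_integral_near a b k e : a <= b ->
  (forall s, a <= s < b -> `|f (fl s) - k| <= e) -> `|I a b - k * (b - a)| <= e * (b - a).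
Proof.
move=> ab fk.
have muab : fine (mu `[a, b[) = b - a.
  rewrite lebesgue_measure_itv/= lte_fin; case: ltP => // ba; rewrite /=.
  by apply/esym/eqP; rewrite subr_eq0 eq_le ab ba.
have Icst c : \int[mu]_(_ in `[a, b[) c = c * (b - a) by rewrite Rintegral_cst// muab.
have cint c : mu.-integrable `[a, b[ (EFin \o (fun=> c)).
  apply: measurable_bounded_integrable => //.
    by rewrite /= lebesgue_measure_itv; case: ifP => _; rewrite ?ltry// -EFinB ltry.
  by exists `|c|; split; [exact: num_real|move=> M cM s _ /=; exact: ltW].
rewrite ler_distl -mulrBl -mulrDl -!Icst; apply/andP; split; apply: le_Rintegral => //.
- exact: step_integrable.
- by move=> s; rewrite /= in_itv/= => /fk; rewrite ler_distl => /andP[].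
- exact: step_integrable.
- by move=> s; rewrite /= in_itv/= => /fk; rewrite ler_distl => /andP[].
Qed.

(** Between s and sigma t, with s close to t, the backward projection stays
    between s and t, so the step function is close to f t there by continuity
    of f at t. *)
Lemma ex_delta_antiderivative : exists F : R -> R,
  F 0 = 0 /\ forall t, TS t -> is_delta_derive TS F t (f t).
Proof.
pose F t := if 0 <= t then I 0 t else - I t 0.
have Iaa a : I a a = 0 by rewrite /I set_itv_ge ?Rintegral_set0// bnd_simp ltxx.
have FB a b : a <= b -> F b - F a = I a b.
  move=> ab; rewrite /F; case: (leP 0 b) => b0; case: (leP 0 a) => a0.
  - by rewrite (step_integralD a0 ab) addrC addKr.
  - by rewrite opprK addrC -step_integralD// ltW.
  - by have := le_trans a0 ab; rewrite leNgt b0.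
  - by rewrite (step_integralD ab (ltW b0)) opprK addrC addrK.
exists F; split=> [|t TSt e e0]; first by rewrite /F lexx Iaa.
have [d d0 dP] := (near_distP _ _).1 ((within_continuousP _ _).1 fcont t TSt e e0).
apply/near_distP; exists d => // s sd TSs.
have close u : (s <= u < sigma t) || (sigma t <= u < s) -> `|f (fl u) - f t| <= e.
  move=> su; apply/ltW/dP; last exact: TS_backward_proj.
  move: su => /orP[/andP[su ut]|/andP[tu us]].
    have sfl := le_backward_proj TSs su.
    have flt : fl u <= t.
      rewrite leNgt; apply/negP => tfl.
      have := le_trans (sigma_le T_gt0 TS0 TSper (TS_backward_proj u) tfl) (backward_proj_le u).
      by rewrite leNgt ut.
    by rewrite ler0_norm ?subr_le0//; apply: le_lt_trans sd; rewrite ler0_norm; lra.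
  have tfl := le_backward_proj TSt (le_trans (le_sigma T_gt0 TS0 TSper t) tu).
  have fls := backward_proj_le u.
  by rewrite ger0_norm ?subr_ge0//; apply: le_lt_trans sd; rewrite ger0_norm; lra.
have [st|ts] := leP s (sigma t).
  rewrite FB// [ `|sigma t - s|]ger0_norm ?subr_ge0//;
    apply: step_integral_near => // u su.
  by apply: close; rewrite su.
rewrite [ `|sigma t - s|]distrC [ `|s - sigma t|]ger0_norm ?subr_ge0 ?(ltW ts)//.
rewrite (_ : _ - _ = - (I (sigma t) s - f t * (s - sigma t))); last first.
  by rewrite -FB ?(ltW ts)//; ring.
by rewrite normrN; apply: step_integral_near (ltW ts) _ => u su; apply: close;
  rewrite su orbT.
Qed.

End Antiderivative.

(** * Continuous periodic functions: primitives and means *)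

Section PeriodicCalculus.
Variables (R : realType) (T : R) (TS : set R).
Hypotheses (T_gt0 : 0 < T) (TScl : closed TS) (TS0 : TS 0).
Hypothesis TSper : forall s, TS (s + T) <-> TS s.

Definition Cper (f : R -> R) := {within TS, continuous f} /\ periodic_on TS T f.

Lemma TS_T : TS T. Proof. by rewrite -[T]add0r; apply/TSper. Qed.

Lemma ex_remainder w : 0 <= w -> exists k, 0 <= w - T *+ k <= T.
Proof.
move=> w0; have exk : exists k, w < T *+ k by exact: ex_mulT.
have := ex_minnP exk; case=> -[|k]; first by rewrite mulr0n ltNge w0.
move=> wk /(_ k) kmin; exists k; rewrite subr_ge0 lerBlDl -mulrSr (ltW wk) andbT.
by rewrite leNgt; apply/negP => /kmin; rewrite ltnn.
Qed.

(** One and the same representative in [0, T] serves all periodic functions. *)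
Lemma periodic_reduce t : TS t -> exists u, [/\ TS u, 0 <= u <= T &
  forall f, periodic_on TS T f -> f t = f u].
Proof.
move=> TSt.
have per k s f : periodic_on TS T f -> TS s -> f (s + T *+ k) = f s.
  move=> fT TSs; elim: k => [|k IH]; first by rewrite mulr0n addr0.
  by rewrite mulrSr addrA fT//; apply/(TS_addn TSper).
have [m tm] := ex_mulT T_gt0 (- t).
have [k kT] : exists k, 0 <= t + T *+ m - T *+ k <= T.
  by apply: ex_remainder; rewrite -lerBlDl sub0r ltW.
have TSw : TS (t + T *+ m) by apply/(TS_addn TSper).
have TSu : TS (t + T *+ m - T *+ k) by apply/(TS_subn TSper).
exists (t + T *+ m - T *+ k); split=> //.
by move=> f fT; rewrite -(per k _ _ fT TSu) subrK per.
Qed.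

Lemma Cper_max f : Cper f -> exists2 u, TS u & forall t, TS t -> f t <= f u.
Proof.
move=> [fc fT]; pose K := TS `&` `[0, T]%classic.
have Kc : compact K by rewrite /K setIC; apply: compact_closedI => //;
  exact: segment_compact.
have fKc : compact (f @` K).
  by apply: continuous_compact Kc; apply: continuous_subspaceW fc => t [].
have fKsup : has_sup (f @` K).
  split; first by exists (f 0), 0 => //; split=> //; rewrite /= in_itv/= lexx ltW.
  have /compact_bounded[M [_ MP]] := fKc.
  exists (M + 1) => y fKy; apply: le_trans (ler_norm _) _.
  by apply: (MP (M + 1)) => //; rewrite ltrDl.
have [u [TSu _] uE] := closed_sup (compact_closed (@Rhausdorff R) fKc) fKsup.
exists u => // t TSt; have [v [TSv vT ->//]] := periodic_reduce TSt.
by rewrite uE; apply: ub_le_sup; [exact: fKsup.2|exists v].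
Qed.

Lemma CperN f : Cper f -> Cper (fun t => - f t).
Proof.
move=> [/within_continuousP fc fT]; split; last by move=> t TSt; rewrite fT.
apply/within_continuousP => t TSt e e0; apply: filterS (fc t TSt e e0) => s + TSs.
by move=> /(_ TSs); rewrite -opprD normrN.
Qed.

Lemma Cper_bounded f : Cper f -> exists2 B, 0 < B & forall t, TS t -> `|f t| <= B.
Proof.
move=> fC; have [u _ uP] := Cper_max fC; have [v _ vP] := Cper_max (CperN fC).
exists (`|f u| + `|f v| + 1) => [|t TSt]; first by rewrite ltr_wpDl// addr_ge0.
have := uP t TSt; have := vP t TSt; rewrite lerN2 ler_norml => h1 h2.
have h3 := ler_norm (f u); have h4 := ler_norm (- f v); rewrite normrN in h4.
have h5 := normr_ge0 (f u); have h6 := normr_ge0 (f v).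
by apply/andP; split; lra.
Qed.

Lemma Cper_gt0 f : Cper f -> (forall t, TS t -> 0 < f t) ->
  exists2 m, 0 < m & forall t, TS t -> m <= f t.
Proof.
move=> fC f0; have [v TSv vP] := Cper_max (CperN fC).
by exists (f v); [exact: f0|move=> t /vP; rewrite lerN2].
Qed.

Lemma CperD f g : Cper f -> Cper g -> Cper (fun t => f t + g t).
Proof.
move=> [/within_continuousP fc fT] [/within_continuousP gc gT].
split; last by move=> t TSt; rewrite fT// gT.
apply/within_continuousP => t TSt e e0.
have e20 : 0 < e / 2 by rewrite divr_gt0.
apply: filterS2 (fc t TSt _ e20) (gc t TSt _ e20) => s + + TSs.
move=> /(_ TSs) A /(_ TSs) B; rewrite opprD addrACA [e]splitr.
by apply: le_lt_trans (ler_normD _ _) _; exact: ltrD.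
Qed.

Lemma Cper_comp (k : R -> R) f : continuous k -> Cper f -> Cper (fun t => k (f t)).
Proof.
move=> kc [/within_continuousP fc fT]; split; last by move=> t TSt; rewrite fT.
apply/within_continuousP => t TSt e e0.
have [d d0 dP] : exists2 d, 0 < d & forall y, `|y - f t| < d -> `|k y - k (f t)| < e.
  apply/near_distP.
  have : \forall y \near f t, `|k (f t) - k y| < e by exact: (cvgrPdist_lt _ _).1 (kc (f t)) e e0.
  by apply: filterS => y; rewrite distrC.
by apply: filterS (fc t TSt d d0) => s + TSs => /(_ TSs)/dP.
Qed.

Lemma Cper_cst c : Cper (fun=> c).
Proof.
split=> //; apply/within_continuousP => t _ e e0; apply: filterE => s _.
by rewrite subrr normr0.
Qed.

(** By polarisation, continuity of a product reduces to that of sums and squares. *)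
Lemma CperM f g : Cper f -> Cper g -> Cper (fun t => f t * g t).
Proof.
move=> fC gC; have sqC u : Cper u -> Cper (fun t => u t ^+ 2).
  by move=> uC; apply: (Cper_comp (k := fun y => y ^+ 2)) uC; exact: exprn_continuous.
have -> : (fun t => f t * g t) =
    (fun t => 4^-1 * ((f t + g t) ^+ 2 + - (f t + - g t) ^+ 2)).
  by apply/funext => t; field.
apply: (Cper_comp (k := fun y => 4^-1 * y)); first exact: mulrl_continuous.
apply: CperD; first exact: sqC (CperD fC gC).
by apply/CperN/(sqC (fun t => f t + - g t))/CperD/CperN.
Qed.

Lemma Cper_shift c f : (forall s, TS (s + c) <-> TS s) -> Cper f ->
  Cper (fun t => f (t + c)).
Proof.
move=> TSc [/within_continuousP fc fT]; split; last first.
  by move=> t TSt; rewrite addrAC fT//; exact/TSc.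
apply/within_continuousP => t TSt e e0.
have /near_distP[d d0 dP] := fc (t + c) ((TSc t).2 TSt) e e0.
apply/near_distP; exists d => // s st TSs; apply: dP; last exact/TSc.
by rewrite (_ : s + c - (t + c) = s - t)//; ring.
Qed.

Lemma delta_le f g F G s t :
  (forall u, TS u -> is_delta_derive TS F u (f u)) ->
  (forall u, TS u -> is_delta_derive TS G u (g u)) ->
  (forall u, TS u -> f u <= g u) -> TS s -> TS t -> s <= t ->
  F t - F s <= G t - G s.
Proof.
move=> Ff Gg fg TSs TSt st.
have := @delta_mean_value _ _ _ T_gt0 TScl TS0 TSper (fun u => F u + - 1 * G u)
  (fun u => f u + - 1 * g u) 0 s t; rewrite mul0r.
have D u : TS u -> is_delta_derive TS (fun u => F u + - 1 * G u) u (f u + - 1 * g u).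
  by move=> TSu; apply: delta_add (Ff u TSu) _; apply: delta_scale; exact: Gg.
move=> /(_ D); have fg0 u : TS u -> f u + - 1 * g u <= 0.
  by move=> /fg; rewrite mulN1r subr_le0.
by move=> /(_ fg0 TSs TSt st); lra.
Qed.

Lemma primitive_uniq f F G s t :
  (forall u, TS u -> is_delta_derive TS F u (f u)) ->
  (forall u, TS u -> is_delta_derive TS G u (f u)) ->
  TS s -> TS t -> F t - F s = G t - G s.
Proof.
move=> Ff Gf; wlog st : s t / s <= t => [W TSs TSt|TSs TSt].
  have [/W|/ltW/W] := leP s t; first by apply.
  by move=> /(_ TSt TSs); lra.
by apply/eqP; rewrite eq_le !(@delta_le f f).
Qed.

Definition primitive (f : R -> R) : R -> R := xget (fun=> 0)
  [set F | F 0 = 0 /\ forall t, TS t -> is_delta_derive TS F t (f t)].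

Lemma primitiveP f : Cper f -> primitive f 0 = 0 /\
  forall t, TS t -> is_delta_derive TS (primitive f) t (f t).
Proof.
move=> fC; have [B _ fB] := Cper_bounded fC.
have [F FP] := ex_delta_antiderivative T_gt0 TScl TS0 TSper fC.1 fB.
by rewrite /primitive; case: xgetP => [G _ //|/(_ F)].
Qed.

Lemma primitiveE f F t : Cper f -> (forall u, TS u -> is_delta_derive TS F u (f u)) ->
  TS t -> primitive f t = F t - F 0.
Proof.
move=> fC Ff TSt; have [f0 fD] := primitiveP fC.
by have := primitive_uniq fD Ff TS0 TSt; rewrite f0 subr0.
Qed.

Definition mean f := primitive f T / T.
(** Removing the mean is what makes the primitive T-periodic. *)
Definition osc f t := primitive f t - mean f * t.

Lemma delta_integral_mean f : Cper f -> T^-1 * delta_integral TS f 0 T = mean f.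
Proof.
move=> fC; rewrite /mean mulrC; congr (_ * _).
have [f0 fD] := primitiveP fC.
rewrite /delta_integral; case: xgetP => [I _ [F [Ff ->]]|].
  by rewrite (primitiveE fC Ff)//; exact: TS_T.
by move=> /(_ (primitive f T))[]; exists (primitive f); rewrite f0 subr0.
Qed.

Lemma osc_delta f t : Cper f -> TS t -> is_delta_derive TS (osc f) t (f t - mean f).
Proof.
move=> fC TSt; rewrite (_ : f t - mean f = f t + - mean f * 1); last by ring.
apply: (eq_delta T_gt0 TScl TS0 TSper TSt (x := fun s => primitive f s + - mean f * s)).
  by move=> s _; rewrite /osc mulNr.
by apply: delta_add; [exact: (primitiveP fC).2|exact: delta_scale (delta_id TS t)].
Qed.

Lemma osc0 f : Cper f -> osc f 0 = 0.
Proof. by move=> fC; rewrite /osc (primitiveP fC).1 mulr0 subr0. Qed.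

Lemma osc_periodic f : Cper f -> periodic_on TS T (osc f).
Proof.
move=> fC t TSt; have [f0 fD] := primitiveP fC.
have FT u : TS u -> is_delta_derive TS (fun t => primitive f (t + T)) u (f u).
  by move=> TSu; rewrite -(fC.2 u TSu); apply: (delta_shift T_gt0 TS0 TSper TSper);
    apply: fD; exact/TSper.
have := primitiveE fC FT TSt; rewrite /osc add0r /mean => ->.
by field; rewrite gt_eqF.
Qed.

Lemma primitive_le f g : Cper f -> Cper g -> (forall t, TS t -> f t <= g t) ->
  primitive f T <= primitive g T.
Proof.
move=> fC gC fg; have [f0 fD] := primitiveP fC; have [g0 gD] := primitiveP gC.
have := delta_le fD gD fg TS0 TS_T (ltW T_gt0); by rewrite f0 g0 !subr0.
Qed.

Lemma mean_le f g : Cper f -> Cper g -> (forall t, TS t -> f t <= g t) ->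
  mean f <= mean g.
Proof. by move=> fC gC fg; rewrite ler_pM2r ?invr_gt0//; exact: primitive_le. Qed.

Lemma mean_cst c : mean (fun=> c) = c.
Proof.
rewrite /mean (@primitiveE _ (fun t => c * t)); last exact: TS_T.
- by rewrite mulr0 subr0 mulfK// gt_eqF.
- exact: Cper_cst.
- by move=> u _; rewrite -[X in is_delta_derive _ _ _ X]mulr1;
    exact: delta_scale (delta_id TS u).
Qed.

Lemma primitive_lin f g c t : Cper f -> Cper g -> TS t ->
  primitive (fun s => f s + c * g s) t = primitive f t + c * primitive g t.
Proof.
move=> fC gC TSt; have [f0 fD] := primitiveP fC; have [g0 gD] := primitiveP gC.
rewrite (@primitiveE _ (fun s => primitive f s + c * primitive g s)) ?f0 ?g0 ?mulr0 ?addr0 ?subr0//.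
  apply: CperD fC _; apply: (Cper_comp (k := fun y => c * y)) gC.
  exact: mulrl_continuous.
by move=> u TSu; apply: delta_add; [exact: fD|apply: delta_scale; exact: gD].
Qed.

Lemma mean_lin f g c : Cper f -> Cper g ->
  mean (fun s => f s + c * g s) = mean f + c * mean g.
Proof.
by move=> fC gC; rewrite /mean primitive_lin// ?mulrDl ?mulrA//; exact: TS_T.
Qed.

Lemma mean_gt0 f : Cper f -> (forall t, TS t -> 0 < f t) -> 0 < mean f.
Proof.
move=> fC f0; have [m m0 mf] := Cper_gt0 fC f0.
apply: lt_le_trans m0 _; rewrite -[leLHS]mean_cst; exact: mean_le (Cper_cst _) fC mf.
Qed.

Lemma mean_norm f B : Cper f -> (forall t, TS t -> `|f t| <= B) -> `|mean f| <= B.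
Proof.
move=> fC fB; rewrite ler_norml; apply/andP; split.
  rewrite -[leLHS]mean_cst; apply: mean_le (Cper_cst _) fC _ => t /fB.
  by rewrite ler_norml => /andP[].
rewrite -[leRHS]mean_cst; apply: mean_le fC (Cper_cst _) _ => t /fB.
by rewrite ler_norml => /andP[].
Qed.

(** The translate of a primitive is a primitive of the translate, and a
    primitive grows by the same amount over every period. *)
Lemma mean_shift c f : (forall s, TS (s + c) <-> TS s) -> Cper f ->
  mean (fun t => f (t + c)) = mean f.
Proof.
move=> TSc fC; rewrite /mean; congr (_ / _); have [f0 fD] := primitiveP fC.
have TSc0 : TS c by rewrite -[c]add0r; exact/TSc.
rewrite (@primitiveE _ (fun t => primitive f (t + c))); last exact: TS_T.
- rewrite add0r [T + c]addrC; have := osc_periodic fC TSc0; rewrite /osc /mean => h.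
  have -> : primitive f (c + T) - primitive f c = primitive f T / T * T by move: h; lra.
  by rewrite divfK// gt_eqF.
- exact: Cper_shift.
- by move=> u TSu; apply: (delta_shift T_gt0 TS0 TSper TSc); apply: fD; exact/TSc.
Qed.

Lemma delta_lipschitz f F B s t :
  (forall u, TS u -> is_delta_derive TS F u (f u)) ->
  (forall u, TS u -> `|f u| <= B) -> TS s -> TS t ->
  `|F t - F s| <= B * `|t - s|.
Proof.
move=> Ff fB; wlog st : s t / s <= t => [W TSs TSt|TSs TSt].
  have [/W|/ltW/W] := leP s t; first by apply.
  by rewrite distrC [ `|t - s|]distrC; apply.
have cD c u : TS u -> is_delta_derive TS (fun s => c * s) u c.
  by move=> _; rewrite -[X in is_delta_derive _ _ _ X]mulr1;
    exact: delta_scale (delta_id TS u).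
have fl u : TS u -> - B <= f u by move=> /fB; rewrite ler_norml => /andP[].
have fu u : TS u -> f u <= B by move=> /fB; rewrite ler_norml => /andP[].
have h1 := delta_le (cD (- B)) Ff fl TSs TSt st.
have h2 := delta_le Ff (cD B) fu TSs TSt st.
by rewrite [ `|t - s|]ger0_norm ?subr_ge0// ler_norml; apply/andP; split; lra.
Qed.

Lemma osc_lipschitz f B s t : Cper f -> (forall u, TS u -> `|f u| <= B) ->
  TS s -> TS t -> `|osc f t - osc f s| <= 2 * B * `|t - s|.
Proof.
move=> fC fB; apply: delta_lipschitz => u TSu; first exact: osc_delta.
apply: le_trans (ler_normB _ _) _.
by have := fB u TSu; have := mean_norm fC fB; lra.
Qed.

Lemma osc_bound f B t : Cper f -> (forall u, TS u -> `|f u| <= B) ->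
  TS t -> `|osc f t| <= 2 * B * T.
Proof.
move=> fC fB TSt; have [u [TSu /andP[u0 uT] ->]] := periodic_reduce TSt;
  last exact: osc_periodic.
have := osc_lipschitz fC fB TS0 TSu; rewrite osc0// !subr0 => /le_trans; apply.
have B0 : 0 <= B by apply: le_trans (fB 0 TS0).
by rewrite ger0_norm// ler_wpM2l// mulr_ge0.
Qed.

Lemma osc_dist f g B t : Cper f -> Cper g -> (forall u, TS u -> `|f u - g u| <= B) ->
  TS t -> `|osc f t - osc g t| <= 2 * B * T.
Proof.
move=> fC gC fgB TSt.
have hC : Cper (fun s => f s + - 1 * g s).
  by under eq_fun do rewrite mulN1r; exact/CperD/CperN.
have := @osc_bound _ B t hC _ TSt; rewrite /osc primitive_lin// mean_lin//.
rewrite (_ : _ - _ - _ = primitive f t + - 1 * primitive g t - (mean f + - 1 * mean g) * t).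
  by apply=> u TSu; rewrite mulN1r; exact: fgB.
by ring.
Qed.

Lemma mean_dist f g B : Cper f -> Cper g -> (forall u, TS u -> `|f u - g u| <= B) ->
  `|mean f - mean g| <= B.
Proof.
move=> fC gC fgB.
have hC : Cper (fun s => f s + - 1 * g s).
  by under eq_fun do rewrite mulN1r; exact/CperD/CperN.
rewrite -mulN1r -mean_lin//; apply: mean_norm => // u TSu; rewrite mulN1r; exact: fgB.
Qed.

Lemma Cper_osc f : Cper f -> Cper (osc f).
Proof.
move=> fC; split; last exact: osc_periodic.
apply/within_continuousP => t TSt e e0.
exact: (delta_continuous T_gt0 TS0 TSper TSt (osc_delta fC TSt) e0).
Qed.

(** For s <= t in one period, x can go from s to t in time t - s and has to
    return in time T - (t - s); the shorter of the two is at most T / 2. *)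
Lemma periodic_oscillation x y b s t : periodic_on TS T x ->
  (forall u, TS u -> is_delta_derive TS x u (y u)) ->
  (forall u, TS u -> `|y u| <= b) -> TS s -> TS t -> `|x t - x s| <= b * T / 2.
Proof.
move=> xT xy yb TSs TSt.
have [s' [TSs' sT ->//]] := periodic_reduce TSs;
  have [t' [TSt' tT ->//]] := periodic_reduce TSt.
wlog st : s' t' TSs' TSt' sT tT / s' <= t' => [W|].
  by have [/W|/ltW/W] := leP s' t'; [exact|rewrite distrC; exact].
have L u v : TS u -> TS v -> `|x v - x u| <= b * `|v - u| by exact: delta_lipschitz xy yb.
move: sT tT => /andP[s0 sT] /andP[t0 tT].
have := L _ _ TSs' TSt'; rewrite [ `|t' - s'|]ger0_norm ?subr_ge0// => h1.
have := L _ _ TSt' ((TSper s').2 TSs'); rewrite xT// distrC.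
have -> : `|s' + T - t'| = T - (t' - s') by rewrite ger0_norm; lra.
by move: h1; lra.
Qed.

(** TS modulo T is compact and a translation maps it into itself, hence onto
    itself: the multiples of r accumulate modulo T, so some of them comes
    back arbitrarily close to 0 modulo T, and then t + r is a limit of points
    of TS obtained from t by subtracting r and adding or subtracting T. *)
Lemma TS_delay_shift r : 0 <= r -> (forall s, TS s -> TS (s - r)) ->
  forall s, TS (s + - r) <-> TS s.
Proof.
move=> r0 TSr; have TSrn s n : TS s -> TS (s - r *+ n).
  move=> TSs; elim: n => [|n IH]; first by rewrite mulr0n subr0.
  by rewrite mulrSr opprD addrA; exact: TSr.
have /choice[m mP] : forall k, exists m, 0 <= r *+ k - T *+ m <= T.
  by move=> k; apply: ex_remainder; exact: mulrn_wge0.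
pose y k := r *+ k - T *+ m k.
have yT : (y @ \oo) `[0, T]%classic by exists 0%N => // k _; rewrite /= in_itv/= mP.
have [z [_ zcl]] := @segment_compact R 0 T _ (fmap_proper_filter y _) yT.
move=> s; split=> [TSs|]; last exact: TSr.
apply: TScl => V /near_distP[d d0 dV].
have d20 : 0 < d / 2 by rewrite divr_gt0.
have ynear n : exists2 k, (n <= k)%N & `|y k - z| < d / 2.
  have [||x [[k nk <-] xz]] := zcl [set y k | k in [set k | n <= k]%N] (ball z (d / 2)).
  - by exists n => // k /= nk; exists k.
  - exact: nbhsx_ballx.
  by exists k => //; rewrite distrC.
have [k _ kz] := ynear 0%N; have [l kl lz] := ynear k.+1.
have lE : l = ((l - k.+1) + k.+1)%N by rewrite subnK.
have E : s - (y l - y k) = (s - r) - r *+ (l - k.+1) + T *+ m l - T *+ m k.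
  by rewrite /y {1}lE mulrnDr mulrSr; ring.
exists (s - (y l - y k)); split.
  rewrite E; apply/(TS_subn TSper)/(TS_addn TSper); exact: TSrn.
apply: dV; rewrite addrC addKr normrN [ltRHS]splitr.
rewrite (_ : y l - y k = (y l - z) - (y k - z)); last by ring.
by apply: le_lt_trans (ler_normB _ _) _; exact: ltrD.
Qed.

Lemma TS_net d : 0 < d -> exists2 S : seq R, (forall s, s \in S -> TS s) &
  forall t, TS t -> 0 <= t <= T -> exists2 s, s \in S & `|t - s| < d.
Proof.
move=> d0; have Kc : compact (`[0, T]%classic `&` TS).
  by apply: compact_closedI => //; exact: segment_compact.
have bop t : (`[0, T]%classic `&` TS) t -> open (ball t d) by move=> _;
  exact: ball_open.
have Kcov : (`[0, T]%classic `&` TS) `<=` cover (`[0, T]%classic `&` TS) (ball^~ d).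
  by move=> t tK; exists t => //; exact: ballxx.
have := Kc; rewrite compact_cover => /(_ _ _ _ bop Kcov)[S SK Scov].
exists S => [s sS|t TSt tT]; first by have /set_mem[] := SK s sS.
have [|s /= sS st] := Scov t; first by split => //; rewrite /= in_itv.
by exists s => //; rewrite distrC.
Qed.

End PeriodicCalculus.

(** * Clipping and uniform convergence on the time scale *)

Definition clip (R : realType) (lo hi y : R) := Num.max lo (Num.min y hi).

Lemma clip_itv (R : realType) (lo hi y : R) : lo <= hi -> lo <= clip lo hi y <= hi.
Proof. by move=> lh; rewrite /clip le_max lexx /= ge_max lh ge_min lexx orbT. Qed.

Lemma clip_dist (R : realType) (lo hi y z : R) :
  `|clip lo hi y - clip lo hi z| <= `|y - z|.
Proof.
have h (y' z' : R) : y' - z' <= `|y' - z'| /\ z' - y' <= `|y' - z'|.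
  by split; [exact: ler_norm|rewrite distrC; exact: ler_norm].
apply: le_trans (_ : `|Num.min y hi - Num.min z hi| <= _).
  rewrite /clip; have [] := h (Num.min y hi) (Num.min z hi).
  move: (Num.min y hi) (Num.min z hi) => u v h1 h2; rewrite ler_norml.
  by case: (leP lo u) => a1; case: (leP lo v) => a2; apply/andP; split; lra.
have [h1 h2] := h y z; rewrite ler_norml.
by case: (leP y hi) => a1; case: (leP z hi) => a2; apply/andP; split; lra.
Qed.

Lemma clip_fix (R : realType) (lo hi d y : R) : lo <= hi -> clip lo hi (d + y) = d ->
  [\/ y = 0, d = lo /\ y < 0 | d = hi /\ 0 < y].
Proof.
move=> lh; have [y0|y0|->] := ltgtP y 0; last by constructor 1.
- rewrite /clip; case: (leP (d + y) hi) => a1; case: leP => a2 e; constructor 2;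
    split=> //; lra.
- rewrite /clip; case: (leP (d + y) hi) => a1; case: leP => a2 e; constructor 3;
    split=> //; apply: le_anti; apply/andP; split; lra.
Qed.

(** Only y is confined to the segment, so that limits can be compared with
    functions whose values may leave it. *)
Lemma segment_uniform_continuity (R : realType) (k : R -> R) (lo hi e : R) :
  continuous k -> 0 < e -> exists2 d, 0 < d & forall y z,
    lo <= y <= hi -> `|y - z| <= d -> `|k y - k z| <= e.
Proof.
move=> kc e0; have /compact_near_coveringP cov := @segment_compact R lo hi.
pose P (d y : R) := forall z, `|y - z| <= d -> `|k y - k z| <= e.
have loc x : `[lo, hi]%classic x -> \forall y \near x & d \near (0 : R)^'+, P d y.
  move=> _; have e20 : 0 < e / 2 by rewrite divr_gt0.
  have : \forall y \near x, `|k x - k y| < e / 2 by exact: (cvgrPdist_lt _ _).1 (kc x) _ e20.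
  move=> /near_distP[d d0 dP]; have d20 : 0 < d / 2 by rewrite divr_gt0.
  exists ([set y | `|y - x| < d / 2], [set r | r < d / 2]).
    split=> /=; first by apply/near_distP; exists (d / 2).
    exact: nbhs_right_lt.
  move=> [y r] /= [yx rd] z yz.
  have h1 : `|k x - k y| < e / 2 by apply: dP; move: yx; lra.
  have h2 : `|k x - k z| < e / 2.
    apply: dP; rewrite (_ : z - x = (y - x) - (y - z)); last by ring.
    by apply: le_lt_trans (ler_normB _ _) _; move: yx rd yz; lra.
  rewrite (_ : k y - k z = (k x - k z) - (k x - k y)); last by ring.
  by apply: le_trans (ler_normB _ _) _; lra.
have near0 := cov R ((0 : R)^'+) P (at_right_proper_filter _) loc.
have [d [dP d0]] := @filter_ex _ _ (at_right_proper_filter (0 : R)) _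
  (filterI near0 (nbhs_right_gt (0 : R))).
exists d => // y z yl; apply: dP.
by rewrite /= in_itv.
Qed.

Lemma segment_bound (R : realType) (k : R -> R) (lo hi : R) : continuous k ->
  exists2 B, 0 < B & forall y, lo <= y <= hi -> `|k y| <= B.
Proof.
move=> kc; have : compact (k @` `[lo, hi]%classic).
  by apply: continuous_compact; [exact: continuous_subspaceT|exact: segment_compact].
move=> /compact_bounded[M [_ MP]]; exists (`|M| + 1); first by rewrite ltr_wpDl.
move=> y yl; apply: (MP (`|M| + 1)); last by exists y => //; rewrite /= in_itv.
by apply: le_lt_trans (ler_norm M) _; rewrite ltrDl.
Qed.

Section UniformConvergence.
Variables (R : realType) (T : R) (TS : set R).
Hypotheses (T_gt0 : 0 < T) (TScl : closed TS) (TS0 : TS 0).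
Hypothesis TSper : forall s, TS (s + T) <-> TS s.
Variables (W : Type) (FF : set_system W).
Context {FFilter : Filter FF}.
Implicit Types (X Y : W -> R -> R) (x y : R -> R).

Definition ucvg X x := forall e, 0 < e ->
  \forall w \near FF, forall t, TS t -> `|X w t - x t| <= e.

Lemma ucvg_cst x : ucvg (fun=> x) x.
Proof. by move=> e e0; apply: filterE => w t _; rewrite subrr normr0 ltW. Qed.

Lemma ucvgD X Y x y : ucvg X x -> ucvg Y y ->
  ucvg (fun w t => X w t + Y w t) (fun t => x t + y t).
Proof.
move=> Xx Yy e e0; have e20 : 0 < e / 2 by rewrite divr_gt0.
apply: filterS2 (Xx _ e20) (Yy _ e20) => w Xw Yw t TSt.
rewrite opprD addrACA [e]splitr; apply: le_trans (ler_normD _ _) _.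
by apply: lerD; [exact: Xw|exact: Yw].
Qed.

Lemma ucvgN X x : ucvg X x -> ucvg (fun w t => - X w t) (fun t => - x t).
Proof.
by move=> Xx e e0; apply: filterS (Xx e e0) => w Xw t /Xw; rewrite -opprD normrN.
Qed.

Lemma ucvgM X Y x y B : (\forall w \near FF, forall t, TS t -> `|X w t| <= B) ->
  (forall t, TS t -> `|y t| <= B) -> ucvg X x -> ucvg Y y ->
  ucvg (fun w t => X w t * Y w t) (fun t => x t * y t).
Proof.
move=> XB yB Xx Yy e e0.
have B0 : 0 < B + 1 by rewrite ltr_wpDl// (le_trans _ (yB 0 TS0)).
have d0 : 0 < e / 2 / (B + 1) by rewrite !divr_gt0.
apply: filterS3 XB (Xx _ d0) (Yy _ d0) => w XwB Xw Yw t TSt.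
rewrite (_ : _ - _ = X w t * (Y w t - y t) + (X w t - x t) * y t); last by ring.
apply: le_trans (ler_normD _ _) _; rewrite !normrM [e]splitr.
have bnd b d : 0 <= b -> 0 <= d -> b <= B -> d <= e / 2 / (B + 1) -> b * d <= e / 2.
  move=> b0 dd0 bB; rewrite ler_pdivlMr// => h; apply: le_trans h.
  by rewrite mulrC ler_wpM2l// (le_trans bB)// lerDl.
apply: lerD; first by apply: bnd => //; [exact: XwB|exact: Yw].
by rewrite mulrC; apply: bnd => //; [exact: yB|exact: Xw].
Qed.

Lemma ucvg_comp (k : R -> R) lo hi X x : continuous k ->
  (forall t, TS t -> lo <= x t <= hi) -> ucvg X x ->
  ucvg (fun w t => k (X w t)) (fun t => k (x t)).
Proof.
move=> kc xl Xx e e0; have [d d0 dP] := segment_uniform_continuity lo hi kc e0.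
apply: filterS (Xx d d0) => w Xw t TSt.
by rewrite distrC; apply: dP; [exact: xl|rewrite distrC; exact: Xw].
Qed.

Lemma ucvg_shift c X x : (forall t, TS t -> TS (t + c)) -> ucvg X x ->
  ucvg (fun w t => X w (t + c)) (fun t => x (t + c)).
Proof.
by move=> TSc Xx e e0; apply: filterS (Xx e e0) => w Xw t /TSc; exact: Xw.
Qed.

Lemma ucvg_osc X x : (\forall w \near FF, Cper T TS (X w)) -> Cper T TS x ->
  ucvg X x -> ucvg (fun w => osc T TS (X w)) (osc T TS x).
Proof.
move=> XC xC Xx e e0; have d0 : 0 < e / (2 * T) by rewrite divr_gt0// mulr_gt0.
apply: filterS2 XC (Xx _ d0) => w XwC Xw t TSt.
have := osc_dist T_gt0 TScl TS0 TSper XwC xC Xw TSt.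
by rewrite mulrAC mulrC divfK// gt_eqF// mulr_gt0.
Qed.

Lemma ucvg_mean X x : (\forall w \near FF, Cper T TS (X w)) -> Cper T TS x ->
  ucvg X x -> (fun w => mean T TS (X w)) @ FF --> mean T TS x.
Proof.
move=> XC xC Xx; apply/cvgrPdist_le => e e0.
apply: filterS2 XC (Xx _ e0) => w XwC Xw; rewrite distrC.
exact: mean_dist.
Qed.

End UniformConvergence.

(** * A solution starting in a gap where the mean force changes sign *)

Lemma closed_all (X : topologicalType) (I : Type) (S : I -> set X) :
  (forall i, closed (S i)) -> closed [set x | forall i, S i x].
Proof.
move=> Scl; rewrite (_ : [set _ | _] = \bigcap_i S i);
  first by apply: closed_bigI => i _; exact: Scl.
by apply/seteqP; split=> x Sx => // i; exact: Sx.
Qed.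

Section OneGap.
Variables (R : realType) (T r a : R) (TS : set R) (phi psi h g p : R -> R).
Hypotheses (T_gt0 : 0 < T) (r_ge0 : 0 <= r) (a_gt0 : 0 < a).
Hypotheses (TScl : closed TS) (TS0 : TS 0) (TSper : forall s, TS (s + T) <-> TS s).
Hypothesis TS_sub_r : forall s, TS s -> TS (s - r).
Hypotheses (psi_cont : continuous psi) (psi_bound : forall y, `|psi y| < a).
Hypotheses (phi_psi : forall y, phi (psi y) = y) (psi0 : psi 0 = 0).
Hypothesis psi_homo : {homo psi : y z / y < z}.
Hypotheses (h_cont : continuous h) (g_cont : continuous g).
Hypotheses (p_C : Cper T TS p) (p_mean : mean T TS p = 0).
Variables (al be ga gb eps : R).
Hypotheses (al_lt_be : al < be) (eps1 : `|eps| = 1).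
Hypothesis sign_al : forall y, al - a * T / 2 < y < al + a * T / 2 ->
  a * `|h y - ga| < eps * g y.
Hypothesis sign_be : forall y, be - a * T / 2 < y < be + a * T / 2 ->
  a * `|h y - gb| < - eps * g y.

Local Notation state := {ptws option R -> R}.
Local Notation mean := (mean T TS).
Local Notation osc := (osc T TS).
Local Notation Cper := (Cper T TS).

(** A state F encodes the pair (c, u): c is [F None] and u t is [F (Some t)].
    Here [vel] is psi(u), the intended delta derivative of x. *)
Definition vel (F : state) t := psi (F (Some t)).
(** The mean of [vel] is removed, so that [pos] is T-periodic for every state;
    it is a primitive of [vel] when that mean is 0. *)
Definition pos (F : state) t := F None + osc (vel F) t.
Definition force (F : state) t := h (pos F t) * vel F t + g (pos F (t + - r)).
Definition rhs (F : state) t := p t + - force F t.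

Let TSr : forall s, TS (s + - r) <-> TS s := TS_delay_shift T_gt0 TScl TSper r_ge0 TS_sub_r.

Variables (H G P : R).
Hypotheses (H_gt0 : 0 < H) (G_gt0 : 0 < G) (P_gt0 : 0 < P).
Hypothesis h_bound : forall y, al - 2 * a * T <= y <= be + 2 * a * T -> `|h y| <= H.
Hypothesis g_bound : forall y, al - 2 * a * T <= y <= be + 2 * a * T -> `|g y| <= G.
Hypothesis p_bound : forall t, TS t -> `|p t| <= P.

Let B := P + (H * a + G).
Let M := 2 * B.
(* Any value larger than M * T, the variation of u over a period. *)
Let D := M * T + 1.

Let B_gt0 : 0 < B. Proof. by rewrite /B !addr_gt0// mulr_gt0. Qed.
Let M_gt0 : 0 < M. Proof. by rewrite mulr_gt0. Qed.
Let D_gt0 : 0 < D. Proof. by rewrite /D addr_gt0// mulr_gt0. Qed.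

(** Off TS the values of u carry no information; setting them to 0 keeps the set
    compact and leaves the fixed points as they are on TS. *)
Definition states : set state := [set F |
  [/\ al <= F None <= be, - D <= F (Some 0) <= D,
      forall s t, TS s -> TS t -> `|F (Some t) - F (Some s)| <= M * `|t - s|,
      forall t, TS t -> F (Some (t + T)) = F (Some t) &
      forall t, ~ TS t -> F (Some t) = 0]].

(** The two clipped terms are corrections that stop when the means of [vel] and
    of [force] vanish, which are the solvability conditions for T-periodicity of
    x and of phi(x^Delta). *)
Definition next_state (F : state) : state := fun i =>
  match i with
  | None => clip al be (F None + eps * mean (force F))
  | Some t => if `[< TS t >]
              then clip (- D) D (F (Some 0) - mean (vel F)) + osc (rhs F) t
              else 0
  end.

Lemma states_Cper F : states F -> Cper (F \o Some).
Proof.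
move=> [_ _ Flip Fper _]; split; last by move=> t TSt /=; exact: Fper.
apply/within_continuousP => t TSt e e0; apply/near_distP; exists (e / M);
  first exact: divr_gt0.
by move=> s; rewrite ltr_pdivlMr// mulrC => st TSs;
  apply: le_lt_trans (Flip _ _ _ _) st.
Qed.

Lemma vel_Cper F : states F -> Cper (vel F).
Proof. by move=> /states_Cper; exact: (Cper_comp psi_cont). Qed.

Lemma vel_le F t : `|vel F t| <= a. Proof. exact/ltW/psi_bound. Qed.

Lemma pos_Cper F : states F -> Cper (pos F).
Proof.
move=> FS; apply: CperD; first exact: Cper_cst.
by apply: Cper_osc => //; exact: vel_Cper.
Qed.

Lemma pos_itv F t : states F -> TS t -> al - 2 * a * T <= pos F t <= be + 2 * a * T.
Proof.
move=> FS TSt; have [/andP[c1 c2] _ _ _ _] := FS.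
have := osc_bound T_gt0 TScl TS0 TSper (vel_Cper FS) (fun t _ => vel_le F t) TSt.
by rewrite ler_norml /pos => /andP[h1 h2]; apply/andP; split; lra.
Qed.

Lemma gpos_Cper F : states F -> Cper (fun t => g (pos F (t + - r))).
Proof.
move=> FS; apply: (Cper_shift (f := fun t => g (pos F t)) TSr).
exact: (Cper_comp g_cont (pos_Cper FS)).
Qed.

Lemma force_Cper F : states F -> Cper (force F).
Proof.
move=> FS; apply: CperD; last exact: gpos_Cper.
by apply: CperM (vel_Cper FS); exact: (Cper_comp h_cont (pos_Cper FS)).
Qed.

Lemma rhs_Cper F : states F -> Cper (rhs F).
Proof. by move=> FS; exact/CperD/CperN/force_Cper. Qed.

Lemma rhs_le F t : states F -> TS t -> `|rhs F t| <= B.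
Proof.
move=> FS TSt; apply: le_trans (ler_normD _ _) _; rewrite normrN.
apply: lerD; first exact: p_bound.
apply: le_trans (ler_normD _ _) _; apply: lerD; last first.
  by apply/g_bound/pos_itv => //; exact/TSr.
by rewrite normrM ler_pM//; [exact/h_bound/pos_itv|exact: vel_le].
Qed.

(** The Lipschitz bound holds after one application of the map, whatever the
    Lipschitz constant was before: |rhs| <= B and its mean is removed. *)
Lemma next_state_in F : states F -> states (next_state F).
Proof.
move=> FS; have qC := rhs_Cper FS.
have next_stateE t : TS t -> next_state F (Some t) =
    clip (- D) D (F (Some 0) - mean (vel F)) + osc (rhs F) t.
  by move=> TSt; rewrite /= asboolT.
split.
- by apply: clip_itv; exact: ltW.
- by rewrite next_stateE// osc0// addr0; apply: clip_itv; rewrite ge0_cp// ltW.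
- move=> s t TSs TSt; rewrite !next_stateE//.
  have E (x y z : R) : (x + y) - (x + z) = y - z by ring.
  rewrite E.  by apply: osc_lipschitz => // u TSu; exact: rhs_le.
- by move=> t TSt; rewrite !next_stateE ?osc_periodic//; exact/TSper.
- by move=> t nTSt; rewrite /= asboolF.
Qed.

Lemma states_nonempty : states !=set0.
Proof.
exists (fun i => if i is Some _ then 0 else al); split=> //=.
- by rewrite lexx ltW.
- by rewrite oppr_le0 (ltW D_gt0).
- by move=> s t _ _; rewrite subrr normr0 mulr_ge0// ltW.
Qed.

Lemma states_convex : convex_family states.
Proof.
move=> F1 F2 k [c1 d1 l1 p1 z1] [c2 d2 l2 p2 z2] k01.
have conv (x y lo hi : R) : lo <= x <= hi -> lo <= y <= hi -> lo <= k * x + (1 - k) * y <= hi.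
  move: k01 => /andP[k0 k1] /andP[x1 x2] /andP[y1 y2].
  have k1' : 0 <= 1 - k by rewrite subr_ge0.
  have A1 := ler_wpM2l k0 x1; have A2 := ler_wpM2l k0 x2.
  have A3 := ler_wpM2l k1' y1; have A4 := ler_wpM2l k1' y2.
  by apply/andP; split; lra.
split; [exact: conv|exact: conv| | |].
- move=> s t TSs TSt.
  rewrite (_ : _ - _ = k * (F1 (Some t) - F1 (Some s)) + (1 - k) * (F2 (Some t) - F2 (Some s))).
    by rewrite ler_norml; apply: conv; rewrite -ler_norml; [exact: l1|exact: l2].
  by ring.
- by move=> t TSt; rewrite p1// p2.
- by move=> t TSt; rewrite z1// z2// !mulr0 addr0.
Qed.

Lemma eval_continuous (i : option R) : continuous (fun F : state => F i).
Proof. by move=> F; exact: (@ptws_eval_cvg _ R F i). Qed.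

Lemma eval_diff_continuous (i j : option R) : continuous (fun F : state => F i - F j).
Proof.
move=> F; have Fi : (fun F : state => F i) @ F --> F i by exact: (@eval_continuous i F).
have Fj : (fun F : state => F j) @ F --> F j by exact: (@eval_continuous j F).
exact: cvgB Fi Fj.
Qed.

Lemma states_compact : compact states.
Proof.
pose box (i : option R) : set R :=
  if i is Some t then `[- (D + M * `|t|), D + M * `|t|]%classic else `[al, be]%classic.
have boxc : compact [set F : state | forall i, box i (F i)].
  by apply: (@tychonoff (option R) (fun=> R)) => -[t|]; exact: segment_compact.
apply: subclosed_compact boxc _; last first.
  move=> F [c d l _ z] [t|]; last by rewrite /box /= in_itv.
  rewrite /box /= in_itv /= -ler_norml; have [TSt|nTSt] := pselect (TS t); last first.
    by rewrite z// normr0 addr_ge0// ?mulr_ge0// ltW.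
  have := l 0 t TS0 TSt; rewrite subr0 => lt0.
  rewrite -[F (Some t)](subrK (F (Some 0))) addrC; apply: le_trans (ler_normD _ _) _.
  by apply: lerD => //; rewrite ler_norml.
have itvc (f : state -> R) lo hi : continuous f -> closed [set F | lo <= f F <= hi].
  move=> fc; rewrite (_ : [set _ | _] = f @^-1` `[lo, hi]%classic).
    by apply: closed_comp => //; exact: itv_closed.
  by apply/seteqP; split=> F; rewrite /= in_itv.
have S1 : closed [set F : state | al <= F None <= be] by apply: itvc;
  exact: eval_continuous.
have S2 : closed [set F : state | - D <= F (Some 0) <= D] by apply: itvc;
  exact: eval_continuous.
have S3 : closed [set F : state | forall st : R * R, TS st.1 -> TS st.2 ->
    `|F (Some st.2) - F (Some st.1)| <= M * `|st.2 - st.1|].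
  apply: closed_all => -[s t] /=; have [TSs|nTSs] := pselect (TS s); last first.
    by rewrite [X in closed X](_ : _ = setT)//; apply/seteqP; split.
  have [TSt|nTSt] := pselect (TS t); last first.
    by rewrite [X in closed X](_ : _ = setT)//; apply/seteqP; split.
  rewrite [X in closed X](_ : _ =
    [set F : state | - (M * `|t - s|) <= F (Some t) - F (Some s) <= M * `|t - s|]).
    by apply: itvc; exact: eval_diff_continuous.
  by apply/seteqP; split=> F /=; rewrite -ler_norml => // FF; exact: FF.
have S4 : closed [set F : state | forall t, TS t -> F (Some (t + T)) = F (Some t)].
  apply: closed_all => t; have [TSt|nTSt] := pselect (TS t); last first.
    by rewrite [X in closed X](_ : _ = setT)//; apply/seteqP; split.
  rewrite [X in closed X](_ : _ = [set F : state | 0 <= F (Some (t + T)) - F (Some t) <= 0]).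
    by apply: itvc; exact: eval_diff_continuous.
  apply/seteqP; split=> F /=; first by move=> ->//; rewrite subrr lexx.
  by move=> FF _; apply/eqP; rewrite -subr_eq0 eq_le andbC.
have S5 : closed [set F : state | forall t, ~ TS t -> F (Some t) = 0].
  apply: closed_all => t; have [TSt|nTSt] := pselect (TS t).
    by rewrite [X in closed X](_ : _ = setT)//; apply/seteqP; split.
  rewrite [X in closed X](_ : _ = [set F : state | 0 <= F (Some t) <= 0]).
    by apply: itvc; exact: eval_continuous.
  apply/seteqP; split=> F /=; first by move=> ->//; rewrite lexx.
  by move=> FF _; apply/eqP; rewrite eq_le andbC.
rewrite (_ : states = [set F : state | al <= F None <= be] `&`
  [set F : state | - D <= F (Some 0) <= D] `&`
  [set F : state | forall st : R * R, TS st.1 -> TS st.2 ->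
    `|F (Some st.2) - F (Some st.1)| <= M * `|st.2 - st.1|] `&`
  [set F : state | forall t, TS t -> F (Some (t + T)) = F (Some t)] `&`
  [set F : state | forall t, ~ TS t -> F (Some t) = 0]).
  by do 4 apply: closedI => //.
apply/seteqP; split=> F [].
  move=> h1 h2 h3 h4 h5; split; last exact: h5.
  split; last exact: h4.
  by split; [split|move=> [s t]; exact: h3].
by move=> [[[h1 h2] h3] h4] h5; split=> // s t TSs TSt; exact: (h3 (s, t)).
Qed.

(** On states, which share a Lipschitz constant and are periodic, closeness on a
    finite net of a period is uniform closeness; uniform convergence then passes
    through each operation that defines the map. *)
Lemma next_state_continuous : {within states, continuous next_state}.
Proof.
apply/subspace_continuousP => F0 F0S.
pose FF := within states (nbhs F0).
have FFF : Filter FF by exact: within_filter.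
have nearS : \forall F \near FF, states F by exact: withinT.
have evc i : (fun F : state => F i) @ FF --> F0 i.
  apply: cvg_within_filter; exact: eval_continuous.
have uU : ucvg TS FF (fun F t => F (Some t)) (fun t => F0 (Some t)).
  move=> e e0; pose d := e / (4 * M).
  have d0 : 0 < d by rewrite divr_gt0// mulr_gt0.
  have [S STS Snet] := TS_net T TScl d0.
  have nearSeq : \forall F \near FF, forall s, s \in S -> `|F (Some s) - F0 (Some s)| < e / 2.
    apply: (@near_all_seq _ FF _ _ (fun s (F : state) => `|F (Some s) - F0 (Some s)| < e / 2)) => s sS.
    have e20 : 0 < e / 2 by rewrite divr_gt0.
    have : \forall F \near FF, `|F0 (Some s) - F (Some s)| < e / 2.
      exact: (cvgrPdist_lt _ _).1 (evc (Some s)) _ e20.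
    by apply: filterS => F; rewrite distrC.
  apply: filterS2 nearS nearSeq => F FS FF0 t TSt.
  have [u [TSu uT ured]] := periodic_reduce T_gt0 TSper TSt.
  have [_ _ l1 p1 _] := FS; have [_ _ l2 p2 _] := F0S.
  have -> : F (Some t) = F (Some u) := ured (F \o Some) p1.
  have -> : F0 (Some t) = F0 (Some u) := ured (F0 \o Some) p2.
  have [s sS us] := Snet u TSu uT.
  have Md : M * `|u - s| <= e / 4.
    rewrite (_ : e / 4 = M * d); first by rewrite ler_wpM2l// ltW.
    by rewrite /d; field; rewrite gt_eqF.
  have h1 := le_trans (l1 s u (STS s sS) TSu) Md.
  have h2 := le_trans (l2 s u (STS s sS) TSu) Md; have h3 := FF0 s sS.
  rewrite (_ : _ - _ = (F (Some u) - F (Some s)) + (F (Some s) - F0 (Some s)) -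
    (F0 (Some u) - F0 (Some s))); last by ring.
  apply: le_trans (ler_normB _ _) _;
    have := ler_normD (F (Some u) - F (Some s)) (F (Some s) - F0 (Some s)).
  by move: h1 h2 h3; lra.
have uV : ucvg TS FF vel (vel F0).
  have [B1 _ F0B] := Cper_bounded T_gt0 TScl TS0 TSper (states_Cper F0S).
  apply: (ucvg_comp (lo := - B1) (hi := B1) psi_cont _ uU) => t TSt.
  by rewrite -ler_norml; exact: F0B.
have nVC : \forall F \near FF, Cper (vel F) by apply: filterS nearS => F;
  exact: vel_Cper.
have uP : ucvg TS FF pos (pos F0).
  apply: ucvgD; last exact: (ucvg_osc T_gt0 TScl TS0 TSper nVC (vel_Cper F0S) uV).
  move=> e e0; have : \forall F \near FF, `|F0 None - F None| < e.
    exact: (cvgrPdist_lt _ _).1 (evc None) _ e0.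
  by apply: filterS => F /ltW; rewrite distrC => FF0 t _.
have uN : ucvg TS FF force (force F0).
  have Hpos := ltW H_gt0; have apos := ltW a_gt0.
  apply: ucvgD.
    apply: (ucvgM (B := H + a) TS0).
    - apply: filterS nearS => F FS t TSt; apply: le_trans (h_bound (pos_itv FS TSt)) _.
      by rewrite lerDl.
    - by move=> t TSt; apply: le_trans (vel_le _ _) _; rewrite lerDr.
    - apply: (ucvg_comp h_cont _ uP) => t; exact: pos_itv.
    - exact: uV.
  apply: (ucvg_shift (X := fun F t => g (pos F t)) (x := fun t => g (pos F0 t))).
    by move=> t TSt; exact/TSr.
  apply: (ucvg_comp g_cont _ uP) => t; exact: pos_itv.
have nNC : \forall F \near FF, Cper (force F) by apply: filterS nearS => F;
  exact: force_Cper.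
have uQ : ucvg TS FF rhs (rhs F0) by apply: ucvgD; [exact: ucvg_cst|exact: ucvgN].
have nQC : \forall F \near FF, Cper (rhs F) by apply: filterS nearS => F;
  exact: rhs_Cper.
have uO : ucvg TS FF (fun F => osc (rhs F)) (osc (rhs F0)).
  by apply: ucvg_osc => //; exact: rhs_Cper.
have mV : (fun F => mean (vel F)) @ FF --> mean (vel F0).
  by apply: ucvg_mean => //; exact: vel_Cper.
have mN : (fun F => mean (force F)) @ FF --> mean (force F0).
  by apply: ucvg_mean => //; exact: force_Cper.
have clipc lo hi (f : state -> R) l : f @ FF --> l ->
    (fun F => clip lo hi (f F)) @ FF --> clip lo hi l.
  move=> fl; apply/cvgrPdist_le => e e0.
  have : \forall F \near FF, `|l - f F| <= e by exact: (cvgrPdist_le _ _).1 fl _ e0.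
  by apply: filterS => F; exact: le_trans (clip_dist _ _ _ _).
suff : next_state @ FF --> next_state F0 by [].
apply: ptws_cvg => -[t|] /=.
  have [TSt|nTSt] := pselect (TS t); last first.
    by rewrite asboolF//; exact: cvg_cst.
  rewrite asboolT//; apply: cvgD.
    have c0 : (fun F : state => F (Some 0) - mean (vel F)) @ FF -->
        F0 (Some 0) - mean (vel F0) by exact: cvgB (evc (Some 0)) mV.
    exact: (clipc _ _ (fun F : state => F (Some 0) - mean (vel F)) _ c0).
  apply/cvgrPdist_le => e e0.
  have uOt : \forall F \near FF, `|osc (rhs F0) t - osc (rhs F) t| <= e.
    by have := uO e e0; apply: filterS => F /(_ t TSt); rewrite distrC.
  exact: uOt.
have eN : (fun F => eps * mean (force F)) @ FF --> eps * mean (force F0).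
  by apply: cvgM => //; exact: cvg_cst.
have c1 : (fun F : state => F None + eps * mean (force F)) @ FF -->
    F0 None + eps * mean (force F0) by exact: cvgD (evc None) eN.
exact: (clipc _ _ (fun F : state => F None + eps * mean (force F)) _ c1).
Qed.

Lemma ex_fixed_state : exists2 F, states F & next_state F = F.
Proof.
exact: (schauder_tychonoff states_nonempty states_compact states_convex
  next_state_in next_state_continuous).
Qed.

Lemma mean_opp f : Cper f -> mean (fun t => - f t) = - mean f.
Proof.
move=> fC; have := mean_lin T_gt0 TScl TS0 TSper (-1) (Cper_cst T TS 0) fC.
rewrite mean_cst// add0r mulN1r => <-; congr mean; apply/funext => t.
by rewrite add0r mulN1r.
Qed.

(** If u(0) = D then u > 0 on a whole period, because u varies by at most
    M T < D there; then psi(u) has positive mean and the clipped value would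
    have been smaller than D.  Symmetrically at -D. *)
Lemma fixed_mean_vel F : states F -> next_state F = F -> mean (vel F) = 0.
Proof.
move=> FS FE; have [_ dD Flip Fper _] := FS; have vC := vel_Cper FS.
have MT u : TS u -> 0 <= u <= T -> `|F (Some u) - F (Some 0)| < D.
  move=> TSu /andP[u0 uT]; apply: le_lt_trans (Flip _ _ TS0 TSu) _.
  rewrite subr0 ger0_norm//; apply: le_lt_trans (_ : M * T < _); last by rewrite ltrDl.
  by rewrite ler_wpM2l// ltW.
have F0E : clip (- D) D (F (Some 0) + - mean (vel F)) = F (Some 0).
  have /(congr1 (fun G : state => G (Some 0))) := FE.
  by rewrite /= asboolT// osc0 ?addr0//; exact: rhs_Cper.
have DD : - D <= D by rewrite ge0_cp// ltW.
have psi_gt0 y : 0 < y -> 0 < psi y by move=> y0; rewrite -psi0; exact: psi_homo.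
have psi_lt0 y : y < 0 -> psi y < 0 by move=> y0; rewrite -[ltRHS]psi0; exact: psi_homo.
have := clip_fix DD F0E; case=> [/eqP|[dE mv]|[dE mv]].
- by rewrite oppr_eq0 => /eqP.
- have : 0 < mean (fun t => - vel F t).
    apply: mean_gt0 => // [|t TSt]; first exact: CperN.
    have [u [TSu uT ured]] := periodic_reduce T_gt0 TSper TSt.
    rewrite (ured _ vC.2) oppr_gt0; apply: psi_lt0.
    by have := MT u TSu uT; rewrite dE ltr_norml; lra.
  by rewrite mean_opp//; move: mv; lra.
- have : 0 < mean (vel F).
    apply: mean_gt0 => // t TSt.
    have [u [TSu uT ured]] := periodic_reduce T_gt0 TSper TSt.
    rewrite (ured _ vC.2); apply: psi_gt0.
    by have := MT u TSu uT; rewrite dE ltr_norml; lra.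
  by move: mv; lra.
Qed.

Lemma pos_delta F t : states F -> mean (vel F) = 0 -> TS t ->
  is_delta_derive TS (pos F) t (vel F t).
Proof.
move=> FS mv TSt; rewrite -[vel F t]add0r; apply: delta_add; first exact: delta_cst.
by have := osc_delta T_gt0 TScl TS0 TSper (vel_Cper FS) TSt; rewrite mv subr0.
Qed.

Lemma pos0 F : states F -> pos F 0 = F None.
Proof. by move=> FS; rewrite /pos osc0 ?addr0//; exact: vel_Cper. Qed.

(** The strict bound on psi improves to a bound smaller than a, since a
    continuous periodic function attains its maximum. *)
Lemma pos_near_start F t : states F -> mean (vel F) = 0 -> TS t ->
  F None - a * T / 2 < pos F t < F None + a * T / 2.
Proof.
move=> FS mv TSt; have vC := vel_Cper FS.
have [w TSw wP] := Cper_max T_gt0 TScl TS0 TSper (Cper_comp (@norm_continuous _ R) vC).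
have := periodic_oscillation T_gt0 TScl TS0 TSper (pos_Cper FS).2
  (fun u => pos_delta FS mv) wP TS0 TSt.
rewrite pos0// => osc_le; rewrite -ltr_distl; apply: le_lt_trans osc_le _.
by rewrite !ltr_pM2r ?invr_gt0//; exact: psi_bound.
Qed.

(** Subtracting c from h costs nothing as the mean of [vel] is 0, and undoing the
    delay in g does not change its mean; the integrand so obtained has the sign
    of [e] pointwise. *)
Lemma mean_force_gt0 F c e : states F -> mean (vel F) = 0 -> `|e| = 1 ->
  (forall y, F None - a * T / 2 < y < F None + a * T / 2 -> a * `|h y - c| < e * g y) ->
  0 < e * mean (force F).
Proof.
move=> FS mv e1 sgn.
have vC := vel_Cper FS; have xC := pos_Cper FS.
have hvC : Cper (fun t => (h (pos F t) + - c) * vel F t).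
  by apply: CperM vC; apply: CperD; [exact: (Cper_comp h_cont xC)|exact: Cper_cst].
have hC : Cper (fun t => h (pos F t) * vel F t).
  by apply: CperM vC; exact: (Cper_comp h_cont xC).
have gC : Cper (fun t => g (pos F t)) by exact: (Cper_comp g_cont xC).
have m1 : mean (force F) = mean (fun t => h (pos F t) * vel F t) + mean (fun t => g (pos F t)).
  rewrite -(mean_shift T_gt0 TScl TS0 TSper TSr gC) -[X in _ = _ + X]mul1r.
  rewrite -mean_lin//; last exact: gpos_Cper.
  by congr mean; apply/funext => t; rewrite mul1r.
have m2 : mean (fun t => h (pos F t) * vel F t) =
          mean (fun t => (h (pos F t) + - c) * vel F t).
  rewrite -[RHS]addr0 -(mulr0 c) -mv -mean_lin//.
  by congr mean; apply/funext => t; ring.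
have -> : e * mean (force F) =
    mean (fun t => 0 + e * ((h (pos F t) + - c) * vel F t + 1 * g (pos F t))).
  have sC : Cper (fun t => (h (pos F t) + - c) * vel F t + 1 * g (pos F t)).
    by under eq_fun do rewrite mul1r; exact: CperD.
  rewrite (mean_lin T_gt0 TScl TS0 TSper e (Cper_cst T TS 0) sC) mean_cst// add0r.
  by rewrite mean_lin// mul1r m1 m2.
have eC : Cper (fun t => 0 + e * ((h (pos F t) + - c) * vel F t + 1 * g (pos F t))).
  apply: CperD; first exact: Cper_cst.
  apply: CperM; first exact: Cper_cst.
  by under eq_fun do rewrite mul1r; exact: CperD.
apply: mean_gt0 => // t TSt.
have := sgn _ (pos_near_start FS mv TSt).
have : `|e * ((h (pos F t) + - c) * vel F t)| <= a * `|h (pos F t) - c|.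
  by rewrite !normrM e1 mul1r mulrC ler_wpM2r// vel_le.
by rewrite ler_norml add0r mul1r => /andP[h1 _] h2; move: h1 h2; lra.
Qed.

(** If c = al then eps times the mean force is positive, so the map would have
    moved c upwards; at c = be it would have moved c downwards. *)
Lemma fixed_mean_force F : states F -> next_state F = F ->
  mean (force F) = 0 /\ al < F None < be.
Proof.
move=> FS FE; have mv := fixed_mean_vel FS FE; have [/andP[c1 c2] _ _ _ _] := FS.
have posal : F None = al -> 0 < eps * mean (force F).
  by move=> cE; apply: (mean_force_gt0 (c := ga) FS mv eps1); rewrite cE.
have negbe : F None = be -> eps * mean (force F) < 0.
  move=> cE; have := mean_force_gt0 (c := gb) (e := - eps) FS mv.
  by rewrite normrN eps1 cE mulNr oppr_gt0; apply.
have cE : clip al be (F None + eps * mean (force F)) = F None.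
  exact: (congr1 (fun G : state => G None) FE).
have := clip_fix (ltW al_lt_be) cE; case=> [e0|[/posal]|[/negbe]]; last 2 first.
- by move=> lt1 /(lt_trans lt1); rewrite ltxx.
- by move=> lt1 /(lt_trans lt1); rewrite ltxx.
split.
  by move/eqP: e0; rewrite mulf_eq0 -normr_eq0 eps1 oner_eq0 => /eqP.
rewrite !lt_def c1 c2 !andbT; apply/andP; split; apply/eqP.
  by move=> /posal; rewrite e0 ltxx.
by move=> /esym/negbe; rewrite e0 ltxx.
Qed.

(** With both means zero, pos^Delta = psi(u) and u^Delta = p - force, which is the
    equation once phi(psi(u)) is read as u. *)
Lemma ex_solution_between : exists x,
  periodic_solution TS T r a phi h g p x /\ al < x 0 < be.
Proof.
have [F FS FE] := ex_fixed_state.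
have mv := fixed_mean_vel FS FE; have [mN c_in] := fixed_mean_force FS FE.
have xE t : TS t -> delta_derive TS (pos F) t = vel F t.
  by move=> TSt; apply: (delta_deriveE T_gt0 TS0 TSper) => //; exact: pos_delta.
have mq : mean (rhs F) = 0.
  rewrite (_ : rhs F = fun t => p t + - 1 * force F t); last first.
    by apply/funext => t; rewrite mulN1r.
  by rewrite mean_lin ?p_mean ?mN ?mulr0 ?addr0//; exact: force_Cper.
have uD t : TS t -> is_delta_derive TS (F \o Some) t (rhs F t).
  move=> TSt; have := osc_delta T_gt0 TScl TS0 TSper (rhs_Cper FS) TSt.
  rewrite mq subr0 => oD; rewrite -[rhs F t]add0r.
  apply: (eq_delta T_gt0 TScl TS0 TSper TSt (x := fun s => F (Some 0) + osc (rhs F) s)).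
    move=> s TSs; rewrite /= -[in RHS]FE /= asboolT//; congr (_ + _).
    rewrite mv subr0 -{1}FE /= asboolT// osc0 ?addr0 ?mv ?subr0//.
    exact: rhs_Cper.
  by apply: delta_add => //; exact: delta_cst.
have phiE t : TS t -> (phi \o delta_derive TS (pos F)) t = F (Some t).
  by move=> TSt; rewrite /= xE// /vel phi_psi.
have phiD t : TS t -> is_delta_derive TS (phi \o delta_derive TS (pos F)) t (rhs F t).
  by move=> TSt; apply: (eq_delta T_gt0 TScl TS0 TSper TSt) (uD t TSt) => s /phiE.
have phiDE t : TS t -> delta_derive TS (phi \o delta_derive TS (pos F)) t = rhs F t.
  by move=> TSt; apply: (delta_deriveE T_gt0 TS0 TSper) => //; exact: phiD.
exists (pos F); split; last by rewrite pos0.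
split.
- split; [exact: (pos_Cper FS).1|exact: (pos_Cper FS).2|split].
    by move=> t TSt; exists (vel F t); exact: pos_delta.
  apply: within_continuous_eq (vel_Cper FS).1 => t TSt; by rewrite xE.
- by move=> t TSt; rewrite xE//; exact: psi_bound.
- split; first by move=> t TSt; exists (rhs F t); exact: phiD.
  apply: within_continuous_eq (rhs_Cper FS).1 => t TSt; by rewrite phiDE.
- by move=> t TSt; rewrite phiDE// xE// /rhs /force; ring.
Qed.

End OneGap.

(** * One solution in each gap *)

Theorem corollary1p3 (R : realType) (T r a : R) (TS : set R)
    (phi h g : R -> R) (n : nat) (alpha gamma : 'I_n.+1 -> R)
    (T_gt0 : 0 < T) (r_ge0 : 0 <= r) (a_gt0 : 0 < a)
    (TS_scale : time_scale TS)
    (TS_periodic : [set t + T | t in TS] = TS)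
    (TS_delay : [set t - r | t in TS] `<=` TS)
    (TS_0 : TS 0)
    (phi_homeo : increasing_homeo a phi) (phi_0 : phi 0 = 0)
    (h_cont : continuous h) (g_cont : continuous g)
    (alpha_incr : forall i j : 'I_n.+1, (i < j)%N -> alpha i < alpha j)
    (hg_sign : forall (j : 'I_n.+1) (x : R),
       x \in `](alpha j - a * T / 2), (alpha j + a * T / 2)[ ->
       a * `| h x - gamma j | < (-1) ^+ j * g x) :
  forall p : R -> R,
    {within TS, continuous p} -> periodic_on TS T p ->
    T^-1 * delta_integral TS p 0 T = 0 ->
    exists u : 'I_n -> R -> R,
      (forall i, periodic_solution TS T r a phi h g p (u i)) /\
      (forall i j, i != j -> exists2 t, TS t & u i t <> u j t).
Proof.
move=> p p_cont p_per p_mean.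
have [_ TScl] := TS_scale.
have TSper s : TS (s + T) <-> TS s.
  split=> [|TSs]; last by rewrite -TS_periodic; exists s.
  by rewrite -{1}TS_periodic => -[t TSt /addIr <-].
have TS_sub_r s : TS s -> TS (s - r) by move=> TSs; apply: TS_delay; exists s.
have [phi_incr _ [psi [psi_cont psi_in phi_psi psi_phi]]] := phi_homeo.
have psi_bound y : `|psi y| < a by have := psi_in y; rewrite in_itv /= ltr_norml.
have psi0 : psi 0 = 0.
  by rewrite -[in LHS]phi_0 psi_phi// in_itv /= oppr_lt0 a_gt0.
have psi_homo : {homo psi : y z / y < z}.
  move=> y z yz; rewrite ltNge; apply/negP; rewrite le_eqVlt => /orP[/eqP zy|zy].
    by move: yz; rewrite -(phi_psi y) -(phi_psi z) zy ltxx.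
  by have := phi_incr _ _ (psi_in z) (psi_in y) zy; rewrite !phi_psi ltNge (ltW yz).
have p_C : Cper T TS p by [].
have mean_p : mean T TS p = 0 by rewrite -delta_integral_mean.
have [P P_gt0 p_bound] := Cper_bounded T_gt0 TScl TS_0 TSper p_C.
pose lo (i : 'I_n) := widen_ord (leqnSn n) i.
pose hi (i : 'I_n) := lift ord0 i.
have between (i : 'I_n) : exists x,
    periodic_solution TS T r a phi h g p x /\ alpha (lo i) < x 0 < alpha (hi i).
  have [H H_gt0 h_bound] := segment_bound (alpha (lo i) - 2 * a * T)
    (alpha (hi i) + 2 * a * T) h_cont.
  have [G G_gt0 g_bound] := segment_bound (alpha (lo i) - 2 * a * T)
    (alpha (hi i) + 2 * a * T) g_cont.
  apply: (ex_solution_between T_gt0 r_ge0 a_gt0 TScl TS_0 TSper TS_sub_r psi_cont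
    psi_bound phi_psi psi0 psi_homo h_cont g_cont p_C mean_p
    (ga := gamma (lo i)) (gb := gamma (hi i)) (eps := (-1) ^+ i) _ _ _ _
    H_gt0 G_gt0 P_gt0 h_bound g_bound p_bound).
  - by apply: alpha_incr; rewrite /lo /hi lift0.
  - by rewrite normrX normrN1 expr1n.
  - by move=> y yI; apply: hg_sign; rewrite in_itv.
  - move=> y yI; have := hg_sign (hi i) y; rewrite in_itv => /(_ yI).
    by rewrite lift0 exprS mulN1r.
have [u uP] := choice between.
exists u; split=> [i|i j]; first exact: (uP i).1.
have u_incr (k l : 'I_n) : (k < l)%N -> u k 0 < u l 0.
  move=> kl; have /andP[_ uk] := (uP k).2; have /andP[ul _] := (uP l).2.
  apply: lt_trans uk (le_lt_trans _ ul).
  have : (hi k <= lo l)%N by rewrite lift0.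
  by rewrite leq_eqVlt => /orP[/eqP/val_inj ->//|/alpha_incr/ltW].
move=> ij; exists 0 => //; apply/eqP; rewrite neq_lt.
by move: ij; rewrite -val_eqE neq_ltn => /orP[/u_incr ->|/u_incr ->]//; rewrite orbT.
Qed.
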